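(* Consider $$x^{\Delta}(t)=a(t)x(t)+b(t)x(\delta_{-}(h,t))\delta_{-}^{\Delta}(h,t),\qquad t\in[t_0,\infty)_{\mathbb{T}},\tag{E}$$ and put $Q(t):=a(t)+b(\delta_{+}(h,t))$ and $\beta(t):=t-\delta_{-}(h,t)$. Let $a\in\mathcal{R}^{+}$ and $Q\in\mathcal{R}$. Assume that there exists $\lambda>0$ such that $$-\frac{\lambda\,\delta_{-}^{\Delta}(h,t)}{\beta(t)+\lambda[\beta(t)+\mu(t)]}\le Q(t)\le-\lambda[\beta(t)+\mu(t)]\,b(\delta_{+}(h,t))^{2}-\mu(t)Q^{2}(t)$$ for all $t\in[t_0,\infty)_{\mathbb{T}}$. Suppose there exists $\alpha\in(t_0,h)_{\mathbb{T}}$ such that $(\alpha,t)\in\mathcal{D}_{\pm}$ for all $t\in[t_0,\infty)_{\mathbb{T}}$ and $$\delta_{-}(h,t)\le\frac{\delta_{-}(\alpha,t)+\delta_{-}(h,\delta_{-}(\alpha,t))}{2}\quad\text{for all }t\in[\alpha,\infty)_{\mathbb{T}}.$$ For a solution $x$ of (E) let $$V(t_0)=\left(x(t_0)+\int_{\delta_{-}(h,t_0)}^{t_0}b(\delta_{+}(h,s))x(s)\,\Delta s\right)^{2}+\lambda\int_{\delta_{-}(h,t_0)}^{t_0}\left(\int_{s}^{t_0}b(\delta_{+}(h,u))^{2}x(u)^{2}\,\Delta u\right)\Delta s,$$ and let $$\Lambda(t):=\delta_{-}(h,t)-\delta_{-}(h,\delta_{-}(\alpha,t)),\qquad \xi(t):=1+\frac{\lambda\Lambda(t)}{\beta(t)}>1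 .$$ Then any solution $x(t)=x(t,t_0,\psi)$ of (E) satisfies $$|x(t)|\le\sqrt{\frac{2}{1-\frac{1}{\xi(t)}}\,V(t_0)}\;\exp\left(\frac12\int_{t_0}^{\delta_{-}(\alpha,t)}Q(s)\,\Delta s\right)$$ for all $t\in[\alpha,\infty)_{\mathbb{T}}$, and $$|x(t)|\le\|\psi\|\,\exp\left(\int_{t_0}^{t}a(s)\,\Delta s\right)\left[1+M\int_{t_0}^{t}\left|\frac{b(s)}{1+\mu(s)a(s)}\right|\exp\left(-\int_{t_0}^{s}a(u)\,\Delta u\right)\Delta s\right]$$ for all $t\in[t_0,\alpha)_{\mathbb{T}}$.
   Context: A time scale $\mathbb{T}$ is a nonempty closed subset of $\mathbb{R}$; $\sigma(t)=\inf\{s\in\mathbb{T}:s>t\}$ is the forward jump operator, $\mu(t)=\sigma(t)-t$, $f^{\Delta}$ is the delta derivative, $\int\cdot\,\Delta s$ the delta integral, and $[a,b]_{\mathbb{T}}=[a,b]\cap\mathbb{T}$ (similarly for other intervals). ''rd-continuous'' means continuous at right-dense points with finite left-sided limits at left-dense points. $\mathcal{R}$ is the set of rd-continuous functions $p$ with $1+\mu(t)p(t)\ne0$ for all $t$ (regressive), and $\mathcal{R}^{+}=\{p\in\mathcal{R}:1+\mu(t)p(t)>0\text{ for all }t\}$. Shift operators. Let $\mathbb{T}^{*}\subseteq\mathbb{T}$ be nonempty and $t_0\in\mathbb{T}^{*}$. Backward and forward shift operators $\delta_{-},\delta_{+}$ associated with the initial point $t_0$ are operators $\delta_{\pm}$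 of $(s,t)\in[t_0,\infty)_{\mathbb{T}}\times\mathbb{T}^{*}$, with domains $\mathcal{D}_{\pm}=\{(s,t)\in[t_0,\infty)_{\mathbb{T}}\times\mathbb{T}^{*}:\delta_{\pm}(s,t)\in\mathbb{T}^{*}\}$ (pairs where the operator is defined with value in $\mathbb{T}^*$), satisfying: P.1: $\delta_{\pm}$ are strictly increasing in their second arguments, i.e. if $(T_0,t),(T_0,u)\in\mathcal{D}_{\pm}$, then $T_0\le t<u$ implies $\delta_{\pm}(T_0,t)<\delta_{\pm}(T_0,u)$. P.2: if $(T_1,u),(T_2,u)\in\mathcal{D}_{-}$ with $T_1<T_2$ then $\delta_{-}(T_1,u)>\delta_{-}(T_2,u)$; if $(T_1,u),(T_2,u)\in\mathcal{D}_{+}$ with $T_1<T_2$ then $\delta_{+}(T_1,u)<\delta_{+}(T_2,u)$. P.3: if $t\in[t_0,\infty)_{\mathbb{T}}$ then $(t,t_0)\in\mathcal{D}_{+}$ and $\delta_{+}(t,t_0)=t$; if $t\in\mathbb{T}^{*}$ then $(t_0,t)\in\mathcal{D}_{+}$ and $\delta_{+}(t_0,t)=t$. P.4: if $(s,t)\in\mathcal{D}_{\pm}$ then $(s,\delta_{\pm}(s,t))\in\mathcal{D}_{\mp}$ and $\delta_{\mp}(s,\delta_{\pm}(s,t))=t$. P.5: if $(s,t)\in\mathcal{D}_{\pm}$ and $(u,\delta_{\pm}(s,t))\in\mathcal{D}_{\mp}$ then $(s,\delta_{\mp}(u,t))\in\mathcal{D}_{\pm}$ and $\delta_{\mp}(u,\delta_{\pm}(s,t))=\delta_{\pm}(s,\delta_{\mp}(u,t))$.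 Delay function. $\mathbb{T}$ is unbounded above, $h\in(t_0,\infty)_{\mathbb{T}}$ is a constant such that $(h,t)\in\mathcal{D}_{\pm}$ for all $t\in[t_0,\infty)_{\mathbb{T}}$, the function $t\mapsto\delta_{-}(h,t)$ is delta differentiable with rd-continuous derivative $\delta_{-}^{\Delta}(h,t)$, is strictly increasing, and maps $[t_0,\infty)_{\mathbb{T}}$ onto $[\delta_{-}(h,t_0),\infty)_{\mathbb{T}}$; its inverse is $\delta_{+}(h,\cdot)$. Standing assumptions: $t_0\ge 0$; $a,b:\mathbb{T}\to\mathbb{R}$ are rd-continuous; $|\delta_{-}^{\Delta}(h,t)|\le M<\infty$ for all $t\in[t_0,\infty)_{\mathbb{T}}$. A solution $x(t)=x(t,t_0,\psi)$ of (E) satisfies (E) on $[t_0,\infty)_{\mathbb{T}}$ and $x=\psi$ on $[\delta_{-}(h,t_0),t_0]_{\mathbb{T}}$, where $\psi:[\delta_{-}(h,t_0),t_0]_{\mathbb{T}}\to\mathbb{R}$ is a given rd-continuous initial function, and $\|\psi\|=\sup\{|\psi(t)|:t\in[\delta_{-}(h,t_0),t_0]_{\mathbb{T}}\}$. *)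

(* Defs.v *)
From HB Require Import structures.
From mathcomp Require Import all_boot all_order all_algebra.
From mathcomp Require Import all_classical all_reals all_analysis.

Set Implicit Arguments.
Unset Strict Implicit.
Unset Printing Implicit Defensive.

Import Order.TTheory GRing.Theory Num.Theory.
Import numFieldNormedType.Exports.

Local Open Scope classical_set_scope.
Local Open Scope ring_scope.

Section TimeScale.
Variable R : realType.
Implicit Types (T A : set R) (f F : R -> R) (a b t l : R).

Definition time_scale T : Prop := T !=set0 /\ closed T.

Definition ts_itv T (i : interval R) : set R := T `&` [set` i].

(* The conventions inf set0 = sup T and sup set0 = inf T are not built in: sigma and
   rho are only used at points that are not, respectively, the maximum and the
   minimum of T. *)
Definition sigma T t : R := inf [set s | T s /\ t < s].
Definition rho T t : R := sup [set s | T s /\ s < t].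
Definition mu T t : R := sigma T t - t.

Definition right_dense T t : Prop := (exists2 s, T s & t < s) /\ sigma T t = t.
Definition left_dense T t : Prop := (exists2 s, T s & s < t) /\ rho T t = t.

(* Density is relative to T, continuity and left limits are those of the
   restriction of f to A, where A is included in T. *)
Definition rd_continuous T A f : Prop :=
  (forall t, A t -> right_dense T t -> f s @[s --> within A (nbhs t)] --> f t) /\
  (forall t, A t -> left_dense T t ->
     exists l, f s @[s --> within [set s | A s /\ s < t] (nbhs t)] --> l).

Definition regressive T A p : Prop :=
  rd_continuous T A p /\ forall t, A t -> 1 + mu T t * p t != 0.

Definition pos_regressive T A p : Prop :=
  regressive T A p /\ forall t, A t -> 0 < 1 + mu T t * p t.

(* l is the delta derivative of f at t on the time scale T. *)
Definition is_delta_deriv T f t l : Prop :=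
  forall e, 0 < e -> \forall s \near t, T s ->
    `|f (sigma T t) - f s - l * (sigma T t - s)| <= e * `|sigma T t - s|.

(* At b only continuity is required: an rd-continuous f need not be
   left-continuous at b when b is right-scattered in T. *)
Definition is_delta_antideriv T a b f F : Prop :=
  {within ts_itv T `[a, b], continuous F} /\
  forall t, ts_itv T `[a, b[ t -> is_delta_deriv (ts_itv T `[a, b]) F t (f t).

(* The Cauchy delta integral. F is determined up to an additive constant on
   [a, b]_T; the value is 0 when f has no antiderivative. *)
Definition delta_int T a b f : R :=
  xget 0 [set F b - F a | F in
    is_delta_antideriv T (Num.min a b) (Num.max a b) f].

End TimeScale.

Section Shift.
Variable R : realType.

(* A partial binary operation: op_val is meaningful only on op_def. *)
Record partial_op := PartialOp {
  op_def : set (R * R);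
  op_val :> R -> R -> R }.

Variables (T Tstar : set R) (t0 : R).

Definition shift_dom (d : partial_op) : set (R * R) :=
  [set p | [/\ ts_itv T `[t0, +oo[ p.1, Tstar p.2,
               op_def d p & Tstar (d p.1 p.2)]].

Definition shift_incr2 (d : partial_op) : Prop :=
  forall s t u, shift_dom d (s, t) -> shift_dom d (s, u) ->
    s <= t -> t < u -> d s t < d s u.

Definition shift_cancel (d e : partial_op) : Prop :=
  forall s t, shift_dom d (s, t) ->
    shift_dom e (s, d s t) /\ e s (d s t) = t.

(* (u, t) in the domain of e expresses that e u t, which occurs in the two
   other conclusions, is defined. *)
Definition shift_commute (d e : partial_op) : Prop :=
  forall s t u, shift_dom d (s, t) -> shift_dom e (u, d s t) ->
    [/\ shift_dom e (u, t), shift_dom d (s, e u t) &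
        e u (d s t) = d s (e u t)].

Record shift_operators (dm dp : partial_op) : Prop := {
  shift_sub : Tstar `<=` T;
  shift_init : Tstar t0;
  shift_P1m : shift_incr2 dm;
  shift_P1p : shift_incr2 dp;
  shift_P2m : forall s1 s2 u, shift_dom dm (s1, u) -> shift_dom dm (s2, u) ->
    s1 < s2 -> dm s2 u < dm s1 u;
  shift_P2p : forall s1 s2 u, shift_dom dp (s1, u) -> shift_dom dp (s2, u) ->
    s1 < s2 -> dp s1 u < dp s2 u;
  shift_P3l : forall t, ts_itv T `[t0, +oo[ t ->
    shift_dom dp (t, t0) /\ dp t t0 = t;
  shift_P3r : forall t, Tstar t -> shift_dom dp (t0, t) /\ dp t0 t = t;
  shift_P4m : shift_cancel dm dp;
  shift_P4p : shift_cancel dp dm;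
  shift_P5m : shift_commute dm dp;
  shift_P5p : shift_commute dp dm }.

(* t |-> dm h t is a delay function with delta derivative dm'. *)
Record delay_function (dm dp : partial_op) (h : R) (dm' : R -> R) : Prop := {
  delay_h : ts_itv T `]t0, +oo[ h;
  delay_dom : forall t, ts_itv T `[t0, +oo[ t ->
    shift_dom dm (h, t) /\ shift_dom dp (h, t);
  delay_deriv : forall t, ts_itv T `[t0, +oo[ t ->
    is_delta_deriv (ts_itv T `[t0, +oo[) (dm h) t (dm' t);
  delay_rd : rd_continuous T (ts_itv T `[t0, +oo[) dm';
  delay_incr : forall t u, ts_itv T `[t0, +oo[ t -> ts_itv T `[t0, +oo[ u ->
    t < u -> dm h t < dm h u;
  delay_onto : dm h @` ts_itv T `[t0, +oo[ = ts_itv T `[dm h t0, +oo[;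
  delay_inv : forall t, ts_itv T `[t0, +oo[ t -> dp h (dm h t) = t }.

(* The delta derivative of x is taken on [t0, oo)_T, hence is one-sided at t0. *)
Definition is_solution (dm : partial_op) (h : R) (dm' a b psi x : R -> R) : Prop :=
  (forall t, ts_itv T `[t0, +oo[ t ->
    is_delta_deriv (ts_itv T `[t0, +oo[) x t
      (a t * x t + b t * x (dm h t) * dm' t)) /\
  (forall t, ts_itv T `[dm h t0, t0] t -> x t = psi t).

End Shift.

(* Main.v *)
Require Import Defs.
From HB Require Import structures.
From mathcomp Require Import all_boot all_order all_algebra.
From mathcomp Require Import all_classical all_reals all_analysis.
From mathcomp Require Import ring lra.

Set Implicit Arguments.
Unset Strict Implicit.
Unset Printing Implicit Defensive.

Import Order.TTheory GRing.Theory Num.Theory.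
Import numFieldNormedType.Exports.

Local Open Scope classical_set_scope.
Local Open Scope ring_scope.

(* The functional
     V t = (x t + int_{dm h t}^t f)^2 + lambda int_{dm h t}^t int_s^t f^2,
   with f s = b (dp h s) * x s, satisfies V^Delta <= Q V: the chain rule for the
   delay makes the derivative of the first bracket equal to Q x, Cauchy-Schwarz
   bounds (int f)^2 by beta int f^2, and the two-sided bound on Q absorbs all the
   other terms. As V >= 0, this gives V t <= V t0 * expR (int Q) even where
   1 + mu Q < 0. Since dm alpha t divides the double integrals suitably,
   V t + V (dm alpha t) dominates (1 - 1 / xi t) * x t ^ 2, while V decreases.
   On [t0, alpha) the delayed argument stays in the initial interval, and the
   second bound says that |x| expR (- int a) grows no faster than the integral of
   the forcing term.

   Everything is reduced to right derivatives: a function that is left-continuous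
   and has right derivative at most 0 (the difference quotient over the gap when t
   is right-scattered) is nonincreasing, by real induction. *)

(** * Real induction and right derivatives *)

(** The value of V at t alone does not control x t: the first bracket may vanish by cancellation
    between x t and the integral I of f, and the double integral weights f u ^ 2 by about u - dm h
    t, which is negligible near the left end dm h t. With m = dm alpha t, the earlier interval
    [dm h m, m] has dm h t in its interior and supplies the missing weight there; hence [Lambda] in
    the bound, and an exponent that stops at m. Adding V t and V m yields I ^ 2 with coefficient
    lambda * Lambda / beta, and minimising over I leaves the factor 1 - 1 / xi.

    No iterated integral is ever differentiated. One antiderivative each of f, of f ^ 2 and of the
    antiderivative of f ^ 2, all on the whole of [dm h t0, t], turns V into an algebraic expression
    in x, these functions and the delay, to which the product and chain rules apply. This is why the
    existence of antiderivatives of rd-continuous functions has to be established. *)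

Section TimeScaleCalculus.
Variables (R : realType) (T : set R).
Hypotheses (T_closed : closed T) (T_unbounded : ~ has_ubound T).
Implicit Types (A B : set R) (f g F G : R -> R) (s t u a b c d l m e : R).

Lemma ts_inf_closed (A : set R) : A `<=` T -> A !=set0 -> has_lbound A ->
  T (inf A).
Proof.
move=> AT A0 lA; apply: T_closed => B /nbhs_ballP[e /= e0 eB].
have [s As se] := inf_adherent e0 (conj A0 lA).
exists s; split; first exact: AT.
apply: eB; rewrite /ball /= ltr_norml; have := ge_inf lA As; lra.
Qed.

(** Real induction through the supremum of the points of [a, b]_T that satisfy [P]. These points
    need not form an initial segment, so the left-limit step may use [P] only at points arbitrarily
    close to t from the left. *)
Lemma ts_ind (P : R -> Prop) (a b : R) : T a -> T b -> a <= b -> P a ->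
  (forall t, T t -> a <= t -> t < b -> P t ->
     exists u, [/\ T u, t < u, u <= b & P u]) ->
  (forall t, T t -> a < t -> t <= b ->
     (forall e, 0 < e -> exists s, [/\ T s, a <= s, t - e < s, s < t & P s]) ->
     P t) ->
  P b.
Proof.
move=> Ta Tb ab Pa right left.
pose A := [set s | [/\ T s, a <= s, s <= b & P s]].
have Aa : A a by split.
have supA : has_sup A by split; [exists a | exists b => s []].
have Tm : T (sup A).
  apply: T_closed; apply: (@closure_subset _ A) => [s []//|].
  by apply: closure_sup; [exists a | case: supA].
have am : a <= sup A by apply: (ub_le_sup supA.2).
have mb : sup A <= b by apply: ge_sup => [|s []//]; exists a.
have Pm : P (sup A).
  have [/eqP <-//|nam] := boolP (a == sup A).
  have am' : a < sup A by rewrite lt_neqAle nam.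
  have [//|nP] := pselect (P (sup A)).
  apply: left => // e e0.
  have [s [Ts as_ sb Ps] es] := sup_adherent e0 supA.
  exists s; split => //; rewrite lt_neqAle; apply/andP; split.
    by apply/eqP => sE; apply: nP; rewrite -sE.
  exact: (ub_le_sup supA.2).
move: mb; rewrite le_eqVlt => /orP[/eqP <-//|mb].
have [u [Tu mu ub Pu]] := right _ Tm am mb Pm.
have : u <= sup A.
  by apply: (ub_le_sup supA.2); split => //; apply: le_trans am (ltW mu).
by rewrite leNgt mu.
Qed.

Lemma near_realP t (P : set R) :
  (\forall s \near t, P s) <->
  (exists2 e, 0 < e & forall s, t - e < s -> s < t + e -> P s).
Proof.
split.
  move=> /nbhs_ballP[e /= e0 eP]; exists e => // s ts st.
  by apply: eP; rewrite /ball /= ltr_norml; lra.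
move=> [e e0 eP]; apply/nbhs_ballP; exists e => //= s.
rewrite /ball /= ltr_norml => /andP[? ?]; apply: eP; lra.
Qed.

Lemma ts_gt t : exists2 u, T u & t < u.
Proof.
apply: contrapT => nu; apply: T_unbounded; exists t => u Tu.
by rewrite leNgt; apply/negP => tu; apply: nu; exists u.
Qed.

Lemma sigmaP t :
  [/\ T (sigma T t), t <= sigma T t & forall s, T s -> t < s -> sigma T t <= s].
Proof.
have [u Tu tu] := ts_gt t.
have A0 : [set s | T s /\ t < s] !=set0 by exists u.
have lA : has_lbound [set s | T s /\ t < s] by exists t => s [_ /ltW].
split; first by apply: ts_inf_closed => // s [].
  by apply: lb_le_inf => // s [_ /ltW].
by move=> s Ts ts; apply: ge_inf.
Qed.

Lemma sigma_in t : T (sigma T t). Proof. by case: (sigmaP t). Qed.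

Lemma sigma_ge t : t <= sigma T t. Proof. by case: (sigmaP t). Qed.

Lemma sigma_le t s : T s -> t < s -> sigma T t <= s.
Proof. by case: (sigmaP t) => _ _; apply. Qed.

Lemma sigma_approx t e : 0 < e ->
  exists s, [/\ T s, t < s & s < sigma T t + e].
Proof.
move=> e0; have [u Tu tu] := ts_gt t.
have hA : has_inf [set s | T s /\ t < s].
  by split; [exists u | exists t => s [_ /ltW]].
by have [s [Ts ts] se] := inf_adherent e0 hA; exists s.
Qed.

Lemma right_denseP t : right_dense T t <-> sigma T t = t.
Proof.
by split=> [[]//|tt]; split=> //; have [u] := ts_gt t; exists u.
Qed.

Lemma mu_ge0 t : 0 <= mu T t.
Proof. by rewrite /mu subr_ge0 sigma_ge. Qed.

(* The filter of right neighbourhoods of t in T; it is principal at sigma t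
   when t is right-scattered, so that limits along it treat both kinds of
   points at once. *)
Definition ts_right t : set_system R :=
  [set U | exists2 u, T u /\ t < u &
    forall s, T s -> t < s -> s <= u -> U s].

Global Instance ts_right_proper t : ProperFilter (ts_right t).
Proof.
split; first by move=> [u [Tu tu] /(_ u Tu tu (lexx u))].
split.
- by have [u Tu tu] := ts_gt t; exists u.
- move=> P Q [u [Tu tu] uP] [v [Tv tv] vQ].
  have [uv|vu] := leP u v.
    exists u => // s Ts ts su; split; first exact: uP.
    by apply: vQ => //; apply: le_trans uv.
  exists v => // s Ts ts sv; split; last exact: vQ.
  by apply: uP => //; apply: le_trans (ltW vu).
- by move=> P Q PQ [u [Tu tu] uP]; exists u => // s *; apply/PQ/uP.
Qed.

Lemma ts_right_gt t : \forall s \near ts_right t, t < s.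
Proof. by have [u Tu tu] := ts_gt t; exists u. Qed.

Lemma ts_right_in t : \forall s \near ts_right t, T s.
Proof. by have [u Tu tu] := ts_gt t; exists u. Qed.

Lemma ts_right_le t u : T u -> t < u -> \forall s \near ts_right t, s <= u.
Proof. by move=> Tu tu; exists u. Qed.

Lemma ts_right_scattered t (U : set R) : t < sigma T t -> U (sigma T t) -> ts_right t U.
Proof.
move=> tt Us; exists (sigma T t); first by split => //; apply: sigma_in.
move=> s Ts ts st; suff -> : s = sigma T t by [].
by apply/eqP; rewrite eq_le st sigma_le.
Qed.

Lemma ts_right_cvg t : s @[s --> ts_right t] --> sigma T t.
Proof.
apply/cvgrPdist_le => e e0; have [u [Tu tu ue]] := sigma_approx t e0.
exists u => // s Ts ts su; have := sigma_le Ts ts.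
rewrite distrC ler_norml; lra.
Qed.

Lemma ts_right_dense t (U : set R) : sigma T t = t ->
  (\forall s \near t, T s -> t < s -> U s) -> ts_right t U.
Proof.
move=> tt /near_realP[e e0 eU].
have [u [Tu tu ue]] := sigma_approx t e0.
exists u => // s Ts ts su; apply: eU => //; lra.
Qed.

Lemma ts_right_denseE t (U : set R) : ts_right t U ->
  \forall s \near t, T s -> t < s -> U s.
Proof.
move=> [u [Tu tu] uU]; apply/near_realP; exists (u - t); first lra.
move=> s ? ? Ts ts; apply: uU => //; lra.
Qed.

Definition ts_left t : set_system R := within [set s | T s /\ s < t] (nbhs t).

Global Instance ts_left_filter t : Filter (ts_left t).
Proof. exact: within_filter. Qed.

Definition rderiv F t l :=
  (F s - F t) / (s - t) @[s --> ts_right t] --> l.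

(** At a left-scattered t the filter [ts_left t] contains the empty set and the condition holds
    vacuously: only left-dense points are constrained. *)
Definition lcont F t := F s @[s --> ts_left t] --> F t.

Definition rantideriv a b f F :=
  (forall t, T t -> a <= t -> t < b -> rderiv F t (f t)) /\
  (forall t, T t -> a < t -> t <= b -> lcont F t).

Lemma rderivP F t l : rderiv F t l <->
  forall e, 0 < e -> \forall s \near ts_right t,
    `|F s - F t - l * (s - t)| <= e * (s - t).
Proof.
split=> [/cvgrPdist_le Fl e e0|Fl].
  near=> s; have st : 0 < s - t.
    by rewrite subr_gt0; near: s; apply: ts_right_gt.
  have : `|l - (F s - F t) / (s - t)| <= e by near: s; apply: Fl.
  rewrite distrC -(ler_pM2r st) -{2}(gtr0_norm st) -normrM mulrBl.
  by rewrite divfK// gt_eqF.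
apply/cvgrPdist_le => e e0; near=> s.
have st : 0 < s - t by rewrite subr_gt0; near: s; apply: ts_right_gt.
rewrite distrC -(ler_pM2r st) -{2}(gtr0_norm st) -normrM mulrBl.
by rewrite divfK ?gt_eqF//; near: s; apply: Fl.
Unshelve. all: by end_near. Qed.

Lemma rderiv_cvg F t l : rderiv F t l ->
  F s @[s --> ts_right t] --> F t + l * mu T t.
Proof.
move=> Fl; have st : s - t @[s --> ts_right t] --> mu T t.
  by apply: cvgB; [apply: ts_right_cvg | apply: cvg_cst].
apply: (cvg_trans _ (cvgD (cvg_cst (F t)) (cvgM Fl st))); apply: near_eq_cvg; near=> s.
have st0 : 0 < s - t by rewrite subr_gt0; near: s; apply: ts_right_gt.
rewrite fctE /= divfK ?gt_eqF// addrC subrK.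
Unshelve. all: by end_near. Qed.

Lemma rderiv_sigma F t l : rderiv F t l -> F (sigma T t) = F t + l * mu T t.
Proof.
move=> Fl; have := sigma_ge t; rewrite le_eqVlt => /orP[/eqP tt|tt].
  by rewrite /mu -tt subrr mulr0 addr0.
apply: (cvg_unique _ _ (rderiv_cvg Fl)); first exact: norm_hausdorff.
by apply: cvg_near_cst; apply: (ts_right_scattered tt).
Qed.

(** The limit is F t at a right-dense point and the value at the next point at a right-scattered
    one. It supplies the shifted factor in the product rule. *)
Lemma rderiv_cvg_sigma F t l : rderiv F t l ->
  F s @[s --> ts_right t] --> F (sigma T t).
Proof. by move=> Fl; rewrite (rderiv_sigma Fl); apply: rderiv_cvg. Qed.

Lemma rderiv_cst c t : rderiv (cst c) t 0.
Proof. by rewrite /rderiv; under eq_fun do rewrite subrr mul0r; apply: cvg_cst. Qed.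

Lemma rderiv_id t : rderiv id t 1.
Proof.
apply/rderivP => e e0; near=> s; rewrite mul1r subrr normr0.
by rewrite mulr_ge0 ?ltW// subr_gt0; near: s; apply: ts_right_gt.
Unshelve. all: by end_near. Qed.

Lemma rderivD F G t l m : rderiv F t l -> rderiv G t m ->
  rderiv (fun s => F s + G s) t (l + m).
Proof.
move=> Fl Gm; rewrite /rderiv.
under eq_fun do rewrite opprD addrACA mulrDl; exact: cvgD.
Qed.

Lemma rderivN F t l : rderiv F t l -> rderiv (fun s => - F s) t (- l).
Proof.
move=> Fl; rewrite /rderiv.
under eq_fun do rewrite -opprD mulNr; exact: cvgN.
Qed.

Lemma rderivB F G t l m : rderiv F t l -> rderiv G t m ->
  rderiv (fun s => F s - G s) t (l - m).
Proof. by move=> Fl Gm; apply: rderivD => //; apply: rderivN. Qed.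

Lemma rderivM F G t l m : rderiv F t l -> rderiv G t m ->
  rderiv (fun s => F s * G s) t (l * G (sigma T t) + F t * m).
Proof.
move=> Fl Gm; apply: (cvg_trans _ (cvgD (cvgM Fl (rderiv_cvg_sigma Gm))
                          (cvgM (cvg_cst (F t)) Gm))).
apply: near_eq_cvg; apply: nearW => s; rewrite !fctE /=; ring.
Qed.

Lemma rderivZ c F t l : rderiv F t l -> rderiv (fun s => c * F s) t (c * l).
Proof.
by move=> /(rderivM (rderiv_cst c t)); rewrite mul0r add0r.
Qed.

Lemma lcontP F t : lcont F t <->
  forall e, 0 < e -> exists2 d, 0 < d &
    forall s, T s -> t - d < s -> s < t -> `|F t - F s| <= e.
Proof.
split=> [/cvgrPdist_le Ft e /Ft|Ft].
  rewrite near_withinE => /near_realP[d d0 dF].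
  exists d => // s Ts ds st; apply: dF => //; lra.
apply/cvgrPdist_le => e /Ft[d d0 dF].
rewrite near_withinE; apply/near_realP; exists d => // s ? ? [? ?]; exact: dF.
Qed.

Lemma lcont_cst c t : lcont (cst c) t. Proof. exact: cvg_cst. Qed.

Lemma lcont_id t : lcont id t.
Proof. by apply: cvg_within_filter; apply: cvg_id. Qed.

Lemma lcontD F G t : lcont F t -> lcont G t -> lcont (fun s => F s + G s) t.
Proof. exact: cvgD. Qed.

Lemma lcontN F t : lcont F t -> lcont (fun s => - F s) t.
Proof. exact: cvgN. Qed.

Lemma lcontB F G t : lcont F t -> lcont G t -> lcont (fun s => F s - G s) t.
Proof. exact: cvgB. Qed.

Lemma lcontM F G t : lcont F t -> lcont G t -> lcont (fun s => F s * G s) t.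
Proof. exact: cvgM. Qed.

Lemma lcont_ext F G c t : c < t ->
  (forall s, T s -> c <= s -> s <= t -> F s = G s) -> T t ->
  lcont F t -> lcont G t.
Proof.
move=> ct FG Tt Ft; rewrite /lcont -(FG t)// ?ltW//; apply: (cvg_trans _ Ft). apply: near_eq_cvg.
rewrite /ts_left near_withinE; apply/near_realP; exists (t - c); first lra.
by move=> s ? ? [? ?]; rewrite FG// ltW//; lra.
Qed.

Lemma ts_nonincreasing g a b : T a -> T b -> a <= b ->
  (forall t, T t -> a < t -> t <= b -> lcont g t) ->
  (forall t, T t -> a <= t -> t < b -> forall e, 0 < e ->
     \forall s \near ts_right t, g s - g t <= e * (s - t)) ->
  g b <= g a.
Proof.
move=> Ta Tb ab gl gr; apply/ler_addgt0Pr => e e0.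
have [-> |ab'] := eqVneq a b; first lra.
have {ab'}ab : a < b by rewrite lt_neqAle ab'.
(* The tolerance e is spread over [a, b] as a slope: the induction keeps [g] below the line of slope
   k through (a, g a). *)
pose k := e / (b - a).
have k0 : 0 < k by rewrite divr_gt0// subr_gt0.
suff : g b <= g a + k * (b - a) by rewrite /k divfK// subr_eq0 gt_eqF.
apply: (ts_ind (P := fun c => g c <= g a + k * (c - a)) Ta Tb (ltW ab)).
- lra.
- move=> t Tt at_ tb gt.
  near (ts_right t) => u; exists u.
  have gu : g u - g t <= k * (u - t) by near: u; apply: gr.
  split; last by move: gu gt; lra.
  + by near: u; apply: ts_right_in.
  + by near: u; apply: ts_right_gt.
  + by near: u; apply: ts_right_le.
- move=> t Tt at_ tb approx; apply/ler_addgt0Pr => r r0.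
  have /lcontP/(_ r r0)[d d0 dg] := gl t Tt at_ tb.
  have [s [Ts as_ ds st gs]] := approx d d0.
  have := dg s Ts ds st; rewrite ler_norml => /andP[_ gts].
  have : k * (s - a) <= k * (t - a) by rewrite ler_pM2l//; lra.
  lra.
Unshelve. all: by end_near. Qed.

Lemma rantideriv_le a b f F k : T a -> T b -> a <= b -> rantideriv a b f F ->
  (forall t, T t -> a <= t -> t < b -> f t <= k) -> F b - F a <= k * (b - a).
Proof.
move=> Ta Tb ab [Fr Fl] fk.
suff : F b - k * b <= F a - k * a by lra.
apply: (@ts_nonincreasing (fun s => F s - k * s)) => //.
  move=> t Tt at_ tb; apply: lcontB; first exact: Fl.
  by apply: lcontM; [apply: lcont_cst | apply: lcont_id].
move=> t Tt at_ tb e e0.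
near=> s.
have : `|F s - F t - f t * (s - t)| <= e * (s - t).
  by near: s; apply: (rderivP _ _ _).1 => //; apply: Fr.
have st : 0 < s - t by rewrite subr_gt0; near: s; apply: ts_right_gt.
rewrite ler_norml => /andP[_].
have : f t * (s - t) <= k * (s - t) by rewrite ler_pM2r// fk.
lra.
Unshelve. all: by end_near. Qed.

Lemma rantiderivN a b f F : rantideriv a b f F ->
  rantideriv a b (fun t => - f t) (fun t => - F t).
Proof.
move=> [Fr Fl]; split=> t *; first by apply: rderivN; apply: Fr.
by apply: lcontN; apply: Fl.
Qed.

Lemma rantiderivB a b f g F G : rantideriv a b f F -> rantideriv a b g G ->
  rantideriv a b (fun t => f t - g t) (fun t => F t - G t).
Proof.
move=> [Fr Fl] [Gr Gl]; split=> t *; first by apply: rderivB; [apply: Fr|apply: Gr].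
by apply: lcontB; [apply: Fl|apply: Gl].
Qed.

Lemma rantiderivZ k a b f F : rantideriv a b f F ->
  rantideriv a b (fun t => k * f t) (fun t => k * F t).
Proof.
move=> [Fr Fl]; split=> t *; first by apply: rderivZ; apply: Fr.
by apply: lcontM; [apply: lcont_cst|apply: Fl].
Qed.

Lemma rantideriv_shift k a b f F : rantideriv a b f F ->
  rantideriv a b f (fun t => F t - k).
Proof.
move=> [Fr Fl]; split=> t *.
  rewrite -[f t]subr0; apply: rderivB; [exact: Fr|exact: rderiv_cst].
by apply: lcontB; [apply: Fl|apply: lcont_cst].
Qed.

Lemma rantideriv_sub a b c d f F : a <= c -> d <= b -> rantideriv a b f F ->
  rantideriv c d f F.
Proof.
move=> ac db [Fr Fl]; split=> t Tt ct td.
  by apply: Fr => //; [apply: le_trans ct | apply: lt_le_trans db].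
by apply: Fl => //; [apply: le_lt_trans ct | apply: le_trans db].
Qed.

Lemma rantideriv_ge a b f F k : T a -> T b -> a <= b -> rantideriv a b f F ->
  (forall t, T t -> a <= t -> t < b -> k <= f t) -> k * (b - a) <= F b - F a.
Proof.
move=> Ta Tb ab /rantiderivN Ff fk.
suff : - F b - - F a <= - k * (b - a) by lra.
by apply: (rantideriv_le Ta Tb ab Ff) => t *; rewrite lerN2 fk.
Qed.

Lemma rantideriv_unique a b f F G : T a -> T b -> a <= b ->
  rantideriv a b f F -> rantideriv a b f G -> F b - F a = G b - G a.
Proof.
move=> Ta Tb ab Ff Gf; have FG := rantiderivB Ff Gf.
have : F b - G b - (F a - G a) <= 0 * (b - a).
  by apply: (rantideriv_le Ta Tb ab FG) => t *; rewrite subrr.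
have : 0 * (b - a) <= F b - G b - (F a - G a).
  by apply: (rantideriv_ge Ta Tb ab FG) => t *; rewrite subrr.
lra.
Qed.

(** * Antiderivatives and the delta integral *)

Lemma ts_itvcc a b t : ts_itv T `[a, b] t <-> [/\ T t, a <= t & t <= b].
Proof.
by rewrite /ts_itv /= in_itv /=; split=> [[? /andP[]]|[? -> ->]].
Qed.

Lemma ts_itvco a b t : ts_itv T `[a, b[ t <-> [/\ T t, a <= t & t < b].
Proof.
by rewrite /ts_itv /= in_itv /=; split=> [[? /andP[]]|[? -> ->]].
Qed.

Lemma ts_itvcy a t : ts_itv T `[a, +oo[ t <-> T t /\ a <= t.
Proof. by rewrite /ts_itv /= in_itv /= andbT. Qed.

Lemma left_denseP t : (forall d, 0 < d -> exists s, [/\ T s, t - d < s & s < t]) <->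
  left_dense T t.
Proof.
split=> [near_t|[[s Ts st] rt] d d0].
  have [s [Ts _ st]] := near_t 1 ltr01.
  split; first by exists s.
  have ubt : has_ubound [set s | T s /\ s < t] by exists t => u [_ /ltW].
  apply/eqP; rewrite eq_le; apply/andP; split.
    by apply: ge_sup => [|u [_ /ltW]//]; exists s.
  apply/ler_addgt0Pr => d d0; have [u [Tu du ut]] := near_t d d0.
  by have : u <= rho T t by [apply: ub_le_sup]; lra.
have hs : has_sup [set s | T s /\ s < t].
  by split; [exists s | exists t => u [_ /ltW]].
have [u [Tu ut]] := sup_adherent d0 hs.
by rewrite -/(rho T t) rt => ?; exists u.
Qed.

(** The strict bound s < u matters at a right-scattered t: there u = [sigma T t] is allowed, only s
    = t remains, and the value of f at [sigma T t] is not constrained. *)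
Lemma rd_right A f t e : rd_continuous T A f -> A t -> ts_right t A -> 0 < e ->
  \forall u \near ts_right t,
    forall s, T s -> t <= s -> s < u -> `|f s - f t| <= e.
Proof.
move=> [fr _] At [v [Tv tv] vA] e0.
have := sigma_ge t; rewrite le_eqVlt => /orP[/eqP tt|tt].
  have /cvgrPdist_le/(_ e e0) := fr t At ((right_denseP t).2 (esym tt)).
  rewrite near_withinE => /near_realP[d d0 dF].
  have [u [Tu tu ud]] := sigma_approx t d0.
  have Tm : T (Num.min u v) by rewrite /Num.min; case: ifP.
  exists (Num.min u v) => [|r Tr tr]; first by rewrite lt_min tu tv.
  rewrite le_min => /andP[ru rv] s Ts; rewrite le_eqVlt => /orP[/eqP <- _|ts sr].
    by rewrite subrr normr0 ltW.
  rewrite distrC; apply: dF; [lra | lra |].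
  by apply: vA => //; lra.
apply: ts_right_scattered => // s Ts; rewrite le_eqVlt => /orP[/eqP <- _|ts].
  by rewrite subrr normr0 ltW.
by rewrite ltNge sigma_le.
Qed.

(** At a point that is not left-dense, a short left neighbourhood contains no point of A, so any l
    serves and 0 is taken. *)
Lemma rd_left A f t e : A `<=` T -> rd_continuous T A f -> A t -> 0 < e ->
  exists l, exists2 d, 0 < d &
    forall s, A s -> t - d < s -> s < t -> `|f s - l| <= e.
Proof.
move=> AT [_ fl] At e0.
have [/fl -/(_ At)[l /cvgrPdist_le/(_ e e0)]|/left_denseP] := pselect (left_dense T t).
  rewrite near_withinE => /near_realP[d d0 dl]; exists l, d => // s As ds st.
  by rewrite distrC; apply: dl => //; lra.
move=> /existsNP[d /not_implyP[d0 nd]]; exists 0, d => // s As ds st.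
by exfalso; apply: nd; exists s; split => //; apply: AT.
Qed.

(** * Existence of antiderivatives through approximate ones *)

Section Existence.
Variables (f : R -> R) (a b : R).
Hypotheses (Ta : T a) (Tb : T b) (ab : a <= b)
  (f_rd : rd_continuous T (ts_itv T `[a, b]) f).

Let approx e F c :=
  (forall t, T t -> a <= t -> t < c -> \forall s \near ts_right t,
     `|F s - F t - f t * (s - t)| <= e * (s - t)) /\
  (forall t, T t -> a < t -> t <= c -> lcont F t).

(** On [c, u) the function f is within e of the constant l, so prolonging F by a segment of slope l
    keeps the error below e. In the induction l is f c when moving to the right, and comes from the
    left limit when closing up at a left-dense point. *)
Local Lemma approx_extend e F c u l : 0 < e -> T c -> a <= c -> c < u -> T u ->
  (forall s, T s -> c <= s -> s < u -> `|f s - l| <= e) ->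
  approx e F c -> exists G, approx e G u.
Proof.
move=> e0 Tc ac cu Tu fl [Fr Fl].
exists (fun s => if s <= c then F s else F c + l * (s - c)); split.
  move=> t Tt at_ tu.
  have [tc|ct] := ltP t c.
    near=> s.
    have sc : s <= c by near: s; apply: ts_right_le.
    by rewrite sc (ltW tc); near: s; apply: Fr.
  near=> s.
  have ts : t < s by near: s; apply: ts_right_gt.
  have -> : (s <= c) = false by apply/negbTE; rewrite -ltNge; lra.
  have -> : (if t <= c then F t else F c + l * (t - c)) = F c + l * (t - c).
    case: ifPn => // tc; have -> : t = c by lra.
    by rewrite subrr mulr0 addr0.
  have -> : F c + l * (s - c) - (F c + l * (t - c)) - f t * (s - t) =
            (l - f t) * (s - t) by ring.
  rewrite normrM distrC (gtr0_norm (_ : 0 < s - t)) ?subr_gt0//.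
  by rewrite ler_pM2r ?subr_gt0// fl.
move=> t Tt at_ tu; have [tc|ct] := leP t c.
  apply: (@lcont_ext F _ a) => //; last exact: Fl.
  by move=> s _ _ st; rewrite (le_trans st tc).
apply: (@lcont_ext (fun s => F c + l * (s - c)) _ c) => //.
  move=> s _ cs _; case: ifPn => // sc; have -> : s = c by lra.
  by rewrite subrr mulr0 addr0.
apply: lcontD; first exact: lcont_cst.
apply: lcontM; first exact: lcont_cst.
by apply: lcontB; [apply: lcont_id | apply: lcont_cst].
Unshelve. all: by end_near. Qed.

Local Lemma approx_exists e : 0 < e -> exists F, approx e F b.
Proof.
move=> e0; apply: (ts_ind (P := fun c => exists F, approx e F c) Ta Tb ab).
- exists (cst 0); split=> t *; [lra|exact: lcont_cst].
- move=> t Tt at_ tb [F Ft].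
  near (ts_right t) => u.
  have Tu : T u by near: u; apply: ts_right_in.
  have tu : t < u by near: u; apply: ts_right_gt.
  exists u; split => //; first by near: u; apply: ts_right_le.
  apply: (@approx_extend e F t u (f t)) => //.
  near: u; apply: (rd_right f_rd) => //; first by apply/ts_itvcc; split => //; lra.
  exists b => // s Ts ts sb; apply/ts_itvcc; split => //; lra.
- move=> t Tt at_ tb near_t.
  have At : ts_itv T `[a, b] t by apply/ts_itvcc; split => //; lra.
  have [|l [d d0 dl]] := rd_left _ f_rd At e0; first by move=> s [].
  have [s [Ts as_ ds st [F Fs]]] := near_t d d0.
  apply: (@approx_extend e F s t l) => // r Tr sr rt.
  apply: dl; [|lra|lra].
  by apply/ts_itvcc; split => //; lra.
Unshelve. all: by end_near. Qed.

(** Both slopes are close to the same f, which cancels in the difference. Approximate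
    antiderivatives thus form a Cauchy family as the tolerance tends to 0. *)
Lemma approx_dist e1 e2 F G s u : approx e1 F b -> approx e2 G b ->
  T s -> T u -> a <= s -> s <= u -> u <= b ->
  F u - F s - (G u - G s) <= (e1 + e2) * (u - s).
Proof.
move=> [Fr Fl] [Gr Gl] Ts Tu as_ su ub.
suff : F u - G u - (e1 + e2) * u <= F s - G s - (e1 + e2) * s by lra.
apply: (@ts_nonincreasing
  (fun s => F s - G s - (e1 + e2) * s)) => //.
  move=> t Tt st tu; apply: lcontB.
    by apply: lcontB; [apply: Fl | apply: Gl] => //; lra.
  by apply: lcontM; [apply: lcont_cst | apply: lcont_id].
move=> t Tt st tu e e0; near=> r.
have tr : 0 < r - t by rewrite subr_gt0; near: r; apply: ts_right_gt.
have : `|F r - F t - f t * (r - t)| <= e1 * (r - t).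
  by near: r; apply: Fr => //; lra.
have : `|G r - G t - f t * (r - t)| <= e2 * (r - t).
  by near: r; apply: Gr => //; lra.
rewrite !ler_norml => /andP[? ?] /andP[? ?].
have : 0 < e * (r - t) by rewrite mulr_gt0.
lra.
Unshelve. all: by end_near. Qed.

(* The exact antiderivative is the supremum of the lower envelopes
   G_e t - G_e a - e (t - a) of the e-approximate ones, which are piecewise linear. *)
Lemma rantideriv_exists : exists F, rantideriv a b f F.
Proof.
have [G Gapprox] : exists G : R -> R -> R, forall e, 0 < e -> approx e (G e) b.
  have /choice[G HG] : forall e, exists F, 0 < e -> approx e F b.
    move=> e; have [e0|e0] := ltP 0 e; last by exists (cst 0) => ?; lra.
    by have [F] := approx_exists e0; exists F.
  by exists G.
pose E t := [set G e t - G e a - e * (t - a) | e in [set e | 0 < e]].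
pose F t := sup (E t).
have ubE e t : 0 < e -> T t -> a <= t -> t <= b ->
    ubound (E t) (G e t - G e a + e * (t - a)).
  move=> e0 Tt at_ tb _ [d /= d0 <-].
  have := approx_dist (Gapprox d d0) (Gapprox e e0) Ta Tt (lexx a) at_ tb; lra.
have FG e t : 0 < e -> T t -> a <= t -> t <= b ->
    `|F t - (G e t - G e a)| <= e * (t - a).
  move=> e0 Tt at_ tb; rewrite ler_norml.
  have : F t <= G e t - G e a + e * (t - a).
    by apply: ge_sup; [exists (G 1 t - G 1 a - 1 * (t - a)); exists 1 => //=|apply: ubE].
  have : G e t - G e a - e * (t - a) <= F t.
    by apply: ub_le_sup; [exists (G e t - G e a + e * (t - a)); apply: ubE|exists e].
  lra.
(* The error is proportional to u - s, whereas two uses of [FG] would give the distances to a. The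
   gain comes from comparing through [G d] with d tending to 0, and it is what lets the slopes pass
   to the supremum. *)
have FG_incr e s u : 0 < e -> T s -> T u -> a <= s -> s <= u -> u <= b ->
    `|F u - F s - (G e u - G e s)| <= e * (u - s).
  move=> e0 Ts Tu as_ su ub; apply/ler_addgt0Pr => r r0.
  (* Chosen so that the errors d * (u - a), d * (s - a) and d * (u - s) add up to at most r. *)
  pose d := r / ((u - s) + 2 * (b - a) + 1).
  have D0 : 0 < (u - s) + 2 * (b - a) + 1 by lra.
  have d0 : 0 < d by rewrite divr_gt0.
  have dr : d * ((u - s) + 2 * (b - a) + 1) = r by rewrite /d divfK// gt_eqF.
  have := FG d u d0 Tu (le_trans as_ su) ub.
  have := FG d s d0 Ts as_ (le_trans su ub).
  have := approx_dist (Gapprox d d0) (Gapprox e e0) Ts Tu as_ su ub.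
  have := approx_dist (Gapprox e e0) (Gapprox d d0) Ts Tu as_ su ub.
  have : d * (u - a) <= d * (b - a) by rewrite ler_pM2l//; lra.
  have : d * (s - a) <= d * (b - a) by rewrite ler_pM2l//; lra.
  rewrite !ler_norml; lra.
exists F; split=> t Tt at_ tb.
  apply/(rderivP _ _ _) => e e0; have e20 : 0 < e / 2 by lra.
  near=> s.
  have Ts : T s by near: s; apply: ts_right_in.
  have ts : t < s by near: s; apply: ts_right_gt.
  have sb : s <= b by near: s; apply: ts_right_le.
  have : `|G (e / 2) s - G (e / 2) t - f t * (s - t)| <= e / 2 * (s - t).
    by near: s; apply: (Gapprox _ e20).1.
  have := FG_incr _ _ _ e20 Tt Ts at_ (ltW ts) sb.
  rewrite !ler_norml; lra.
apply/lcontP => e e0; have e20 : 0 < e / 2 by lra.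
(* For left-continuity the approximation [G 1] is enough: its increment error t - s is below e / 2
   this close to t. *)
have /lcontP/(_ _ e20)[d d0 dG] := (Gapprox 1 ltr01).2 t Tt at_ tb.
exists (Num.min d (Num.min (e / 2) (t - a))).
  by rewrite !lt_min d0 e20 subr_gt0.
move=> s Ts; rewrite ltrBlDl addrC -ltrBlDl !lt_min => /and3P[sd se sa] st.
have := dG s Ts; have := FG_incr 1 s t ltr01 Ts Tt; rewrite !ler_norml => H1 H2.
have := H1 ltac:(lra) ltac:(lra) tb; have := H2 ltac:(lra) st; lra.
Unshelve. all: by end_near. Qed.

Lemma rd_bounded : exists K, forall t, T t -> a <= t -> t <= b -> `|f t| <= K.
Proof.
(* The bound is propagated on [a, c) with c excluded, because the left limit at c says nothing about
   f c; the endpoint b is added at the end. *)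
have [K bK] : exists K, forall t, T t -> a <= t -> t < b -> `|f t| <= K.
  apply: (ts_ind (P := fun c => exists K, forall t, T t -> a <= t -> t < c ->
    `|f t| <= K) Ta Tb ab).
  - by exists 0 => t; lra.
  - move=> t Tt at_ tb [K Kt].
    near (ts_right t) => u.
    exists u; split.
    + by near: u; apply: ts_right_in.
    + by near: u; apply: ts_right_gt.
    + by near: u; apply: ts_right_le.
    have fu : forall s, T s -> t <= s -> s < u -> `|f s - f t| <= 1.
      near: u; apply: (rd_right f_rd) => //; first by apply/ts_itvcc; split => //; lra.
      exists b => // s Ts ts sb; apply/ts_itvcc; split => //; lra.
    exists (Num.max K (`|f t| + 1)) => s Ts as_ su; rewrite le_max.
    have [st|ts] := ltP s t; first by rewrite Kt.
    apply/orP; right; have := fu s Ts ts su.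
    have := ler_normD (f s - f t) (f t); rewrite subrK; lra.
  - move=> t Tt at_ tb near_t.
    have At : ts_itv T `[a, b] t by apply/ts_itvcc; split => //; lra.
    have [|l [d d0 dl]] := rd_left _ f_rd At ltr01; first by move=> s [].
    have [s [Ts as_ ds st [K Ks]]] := near_t d d0.
    exists (Num.max K (`|l| + 1)) => r Tr ar rt; rewrite le_max.
    have [rs|sr] := ltP r s; first by rewrite Ks.
    have : `|f r - l| <= 1.
      by apply: dl; [apply/ts_itvcc; split => //|..]; lra.
    move=> frl; apply/orP; right.
    have := ler_normD (f r - l) l; rewrite subrK; lra.
exists (Num.max K `|f b|) => t Tt at_; rewrite le_max le_eqVlt.
move=> /orP[/eqP ->|tb]; first by rewrite lexx orbT.
by rewrite bK.
Unshelve. all: by end_near. Qed.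

End Existence.

(** The forward jump depends only on the points just to the right of t. This lets derivatives taken
    on [t0, oo)_T or on [a, b]_T be read on T. *)
Lemma sigma_sub S t : S `<=` T -> ts_right t S -> sigma S t = sigma T t.
Proof.
move=> ST [u [Tu tu] uS].
have S0 : [set s | S s /\ t < s] !=set0 by exists u; split => //; apply: uS.
apply/eqP; rewrite eq_le; apply/andP; split.
  apply/ler_addgt0Pr => e e0; have [s [Ts ts se]] := sigma_approx t e0.
  have Tm : T (Num.min s u) by rewrite /Num.min; case: ifP.
  have tm : t < Num.min s u by rewrite lt_min ts.
  have Sm : S (Num.min s u) by apply: uS; rewrite // ge_min lexx orbT.
  apply: le_trans (_ : Num.min s u <= _); last by rewrite ge_min ltW.
  by apply: ge_inf; [exists t => r [_ /ltW]|].
by apply: lb_le_inf => // s [/ST Ts ts]; apply: sigma_le.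
Qed.

(** Taking s = t in the definition leaves an error of e times the graininess for every e > 0, hence
    none. *)
Lemma delta_deriv_sigma S F t l : is_delta_deriv S F t l -> S t ->
  F (sigma S t) = F t + l * (sigma S t - t).
Proof.
move=> Fl St; apply/eqP; rewrite -subr_eq0 -normr_eq0 eq_le normr_ge0 andbT.
apply/ler_addgt0Pr => e e0; rewrite add0r.
have k0 : 0 < `|sigma S t - t| + 1 by rewrite ltr_pwDr.
have /Fl/nbhs_singleton/(_ St) : 0 < e / (`|sigma S t - t| + 1) by rewrite divr_gt0.
rewrite opprD addrA => /le_trans; apply.
rewrite -mulrA ler_piMr ?(ltW e0)// mulrC ler_pdivrMr// mul1r.
lra.
Qed.

Lemma delta_deriv_rderiv S F t l : S `<=` T -> S t -> ts_right t S ->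
  is_delta_deriv S F t l -> rderiv F t l.
Proof.
move=> ST St tS Fl; apply/rderivP => e e0.
have sE := sigma_sub ST tS; have Fs := delta_deriv_sigma Fl St.
have := sigma_ge t; rewrite le_eqVlt => /orP[/eqP tt|tt].
  have [u [Tu tu] uS] := tS.
  apply: ts_right_dense => //; have /near_realP[d d0 dF] := Fl e e0.
  apply/near_realP; exists (Num.min d (u - t)).
    by rewrite lt_min d0 subr_gt0.
  move=> s; rewrite -[_ < t + _]ltrBlDl !lt_min => _ /andP[sd su] Ts ts.
  have Ss : S s by apply: uS => //; lra.
  have := dF s ltac:(lra) ltac:(lra) Ss.
  rewrite sE -tt !(ler_norml, ltr0_norm (_ : t - s < 0)) ?subr_lt0//.
  lra.
apply: ts_right_scattered => //; rewrite -sE Fs.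
rewrite [X in `|X|](_ : _ = 0); first by rewrite normr0 mulr_ge0 ?ltW// sE subr_gt0.
ring.
Qed.

Lemma delta_deriv_cvg S F t l : S t -> is_delta_deriv S F t l ->
  F s @[s --> within S (nbhs t)] --> F t.
Proof.
move=> St Fl; have Fs := delta_deriv_sigma Fl St.
apply/cvgrPdist_le => e e0.
set m := sigma S t - t in Fs.
have K0 : 0 < `|m| + `|l| + 2 by rewrite ltr_wpDl ?addr_ge0.
have [k k0 ke] : exists2 k, 0 < k & k * (`|m| + `|l| + 2) = e.
  by exists (e / (`|m| + `|l| + 2)); rewrite ?divr_gt0// divfK// gt_eqF.
have /near_realP[d d0 dF] := Fl _ k0.
rewrite near_withinE; apply/near_realP.
exists (Num.min d (Num.min 1 k)); first by rewrite !lt_min d0 ltr01 k0.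
move=> s; rewrite ltrBlDl addrC -ltrBlDl -ltrBlDl !lt_min.
move=> /and3P[? ? ?] /and3P[? ? ?] Ss.
have := dF s ltac:(lra) ltac:(lra) Ss.
rewrite Fs -/m (_ : sigma S t - s = m + (t - s)); last by rewrite /m; ring.
move=> H.
have -> : F t - F s = (F t + l * m - F s - l * (m + (t - s))) + l * (t - s) by ring.
have ts1 : `|t - s| <= 1 by rewrite ler_norml; lra.
have tsk : `|t - s| <= k by rewrite ler_norml; lra.
apply: le_trans (ler_normD _ _) _; rewrite normrM.
apply: le_trans (lerD H (ler_wpM2l (normr_ge0 l) tsk)) _.
have : k * `|m + (t - s)| <= k * (`|m| + 1).
  by rewrite ler_pM2l// (le_trans (ler_normD _ _))// lerD.
rewrite -ke; lra.
Qed.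

Lemma delta_deriv_lcont S F t l : S t ->
  (\forall s \near t, T s -> s < t -> S s) ->
  is_delta_deriv S F t l -> lcont F t.
Proof.
move=> St tS /(delta_deriv_cvg St); apply: cvg_trans.
move=> U /=; rewrite /fmap /= => US.
rewrite /ts_left !near_simpl !near_withinE in US *.
by apply: filterS2 tS US => s tSs USs [Ts st]; apply: USs; apply: tSs.
Qed.

Lemma ts_right_itvcc a b t : T b -> a <= t -> t < b -> ts_right t (ts_itv T `[a, b]).
Proof.
by move=> Tb at_ tb; exists b => // s Ts ts sb; apply/ts_itvcc; split => //; lra.
Qed.

Lemma delta_antideriv_rantideriv a b f F : T a -> T b ->
  is_delta_antideriv T a b f F -> rantideriv a b f F.
Proof.
move=> Ta Tb [Fc Fd]; split=> t Tt at_ tb.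
  apply: (@delta_deriv_rderiv (ts_itv T `[a, b])) => //.
  - by move=> s [].
  - by apply/ts_itvcc; split => //; lra.
  - exact: ts_right_itvcc.
  - by apply: Fd; apply/ts_itvco.
have /subspace_continuousP/(_ t) := Fc.
move=> /(_ ltac:(by apply/ts_itvcc; split => //; lra)).
apply: cvg_trans => U /=; rewrite /fmap /= => US.
rewrite /ts_left !near_simpl !near_withinE in US *.
have ta : 0 < t - a by lra.
near=> s => -[Ts st].
have tas : t - (t - a) < s.
  by near: s; apply/near_realP; exists (t - a).
have : ts_itv T `[a, b] s by apply/ts_itvcc; split => //; lra.
by near: s.
Unshelve. all: by end_near. Qed.

Lemma rantideriv_cvg a b f F t : rantideriv a b f F -> ts_itv T `[a, b] t ->
  F s @[s --> within (ts_itv T `[a, b]) (nbhs t)] --> F t.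
Proof.
move=> [Fr Fl] /ts_itvcc[Tt at_ tb].
apply/cvgrPdist_le => e e0; rewrite near_withinE.
have R1 : \forall s \near t, ts_itv T `[a, b] s -> t < s -> `|F t - F s| <= e.
  have := tb; rewrite le_eqVlt => /orP[/eqP ->|tb'].
    by near=> s => /ts_itvcc[]; lra.
  have := sigma_ge t; rewrite le_eqVlt => /orP[/eqP tt|tt].
    have /cvgrPdist_le/(_ e e0)/ts_right_denseE := rderiv_cvg_sigma (Fr t Tt at_ tb').
    rewrite -tt; apply: filterS => s H [Ts _]; exact: H.
  near=> s => -[Ts _] ts; have := sigma_le Ts ts; rewrite leNgt => /negP[].
  near: s; apply/near_realP; exists (sigma T t - t); first by rewrite subr_gt0.
  by move=> s; lra.
have L1 : \forall s \near t, ts_itv T `[a, b] s -> s < t -> `|F t - F s| <= e.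
  have := at_; rewrite le_eqVlt => /orP[/eqP <-|at'].
    by near=> s => /ts_itvcc[]; lra.
  have /lcontP/(_ e e0)[d d0 dF] := Fl t Tt at' tb.
  apply/near_realP; exists d => // s ds _ [Ts _] st; exact: dF.
near=> s => As; have [st|ts|->] := ltgtP s t; last by rewrite subrr normr0 ltW.
- by move: st; move: As; near: s.
- by move: ts; move: As; near: s.
Unshelve. all: by end_near. Qed.

(** The delta derivative is two-sided. At a right-dense t, f is continuous and the mean value bounds
    on [s, t] give the derivative from the left; at a right-scattered t, continuity of F suffices
    because [sigma T t - s] stays away from 0. *)
Lemma rantideriv_delta_antideriv a b f F : T a -> T b ->
  rd_continuous T (ts_itv T `[a, b]) f -> rantideriv a b f F ->
  is_delta_antideriv T a b f F.
Proof.
move=> Ta Tb frd Ff; have [Fr Fl] := Ff; split.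
  by apply/subspace_continuousP => t; apply: (rantideriv_cvg Ff).
move=> t /ts_itvco[Tt at_ tb] e e0.
have sE : sigma (ts_itv T `[a, b]) t = sigma T t.
  by apply: sigma_sub; [move=> s [] | apply: ts_right_itvcc].
have Fd := Fr t Tt at_ tb.
have Fs := rderiv_sigma Fd; rewrite /mu in Fs.
rewrite sE Fs.
have At : ts_itv T `[a, b] t by apply/ts_itvcc; split => //; lra.
have Fcvg := rantideriv_cvg Ff At.
have := sigma_ge t; rewrite le_eqVlt => /orP[/eqP tt|tt].
- rewrite -tt subrr mulr0 addr0.
  have R1 : \forall s \near t, T s -> t < s ->
      `|F t - F s - f t * (t - s)| <= e * `|t - s|.
    have /rderivP/(_ e e0)/ts_right_denseE := Fd.
    apply: filterS => s H Ts ts; move: (H Ts ts).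
    rewrite -[`|F t - F s - _|]normrN (ltr0_norm (_ : t - s < 0)) ?subr_lt0//.
    by rewrite !opprB addrA [f t * _ + _ - _](_ : _ = F s - F t - f t * (s - t))//; ring.
  have L1 : \forall s \near t, ts_itv T `[a, b] s -> s < t ->
      `|F t - F s - f t * (t - s)| <= e * `|t - s|.
    have /cvgrPdist_le/(_ e e0) := frd.1 t At ((right_denseP t).2 (esym tt)).
    rewrite near_withinE => /near_realP[d d0 df].
    apply/near_realP; exists d => // s ds _ /ts_itvcc[Ts as_ sb] st.
    have Fst : rantideriv s t f F by apply: rantideriv_sub Ff => //; lra.
    rewrite (gtr0_norm (_ : 0 < t - s)) ?subr_gt0// ler_norml.
    have fb r : T r -> s <= r -> r < t -> `|f t - f r| <= e.
      by move=> Tr sr rt; apply: df; [lra|lra|apply/ts_itvcc; split => //; lra].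
    have : F t - F s <= (f t + e) * (t - s).
      apply: (rantideriv_le Ts Tt (ltW st) Fst) => r Tr sr rt.
      by have := fb r Tr sr rt; rewrite ler_norml; lra.
    have : (f t - e) * (t - s) <= F t - F s.
      apply: (rantideriv_ge Ts Tt (ltW st) Fst) => r Tr sr rt.
      by have := fb r Tr sr rt; rewrite ler_norml; lra.
    lra.
  near=> s => As; have [st|ts|->] := ltgtP s t.
  + by move: st; move: As; near: s.
  + by move: ts; move: As.1; near: s.
  + by rewrite !subrr mulr0 subr0 normr0 mulr0.
- set m := sigma T t - t; have m0 : 0 < m by rewrite subr_gt0.
  have cv : F t + f t * m - F s - f t * (sigma T t - s)
      @[s --> within (ts_itv T `[a, b]) (nbhs t)] -->
      F t + f t * m - F t - f t * (sigma T t - t).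
    apply: cvgB; first by apply: cvgB => //; apply: cvg_cst.
    apply: cvgM; first exact: cvg_cst.
    by apply: cvgB; [apply: cvg_cst | apply: cvg_within].
  have em : 0 < e * (m / 2) by rewrite mulr_gt0// divr_gt0.
  move/cvgrPdist_le/(_ _ em) : cv; rewrite near_withinE => cv.
  near=> s => As; have : F t + f t * m - F s - f t * (sigma T t - s) =
     - ((F t + f t * m - F t - f t * (sigma T t - t)) -
       (F t + f t * m - F s - f t * (sigma T t - s))) by rewrite /m; ring.
  move=> ->; rewrite normrN; apply: (@le_trans _ _ (e * (m / 2))).
    by move: As; near: s.
  have sm : s < t + m / 2.
    near: s; apply/near_realP; exists (m / 2); first lra.
    by move=> s _.
  by rewrite ler_pM2l// (le_trans _ (ler_norm _))//; move: sm; rewrite /m; lra.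
Unshelve. all: by end_near. Qed.

(** [xget] returns the value for some antiderivative, since one exists and the default 0 is not
    reached; uniqueness up to a constant then identifies that value. *)
Lemma delta_intE a b f F : T a -> T b -> a <= b ->
  rd_continuous T (ts_itv T `[a, b]) f -> rantideriv a b f F ->
  delta_int T a b f = F b - F a.
Proof.
move=> Ta Tb ab frd Ff; rewrite /delta_int (min_l ab) (max_r ab).
set P := [set _ | _ in _]; have : P (xget 0 P).
  apply: xgetPex; exists (F b - F a); exists F => //.
  exact: rantideriv_delta_antideriv.
move=> [G Gf <-].
by apply: (rantideriv_unique Ta Tb ab _ Ff); apply: delta_antideriv_rantideriv.
Qed.

(** * Stability properties of rd-continuity *)

Lemma rd_subset A B f : B `<=` A -> rd_continuous T A f -> rd_continuous T B f.
Proof.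
move=> BA [fr fl]; split=> t Bt tt.
  by apply: cvg_trans (fr t (BA t Bt) tt); apply: cvg_app; apply: within_subset.
have [l fl'] := fl t (BA t Bt) tt; exists l.
apply: cvg_trans fl'; apply: cvg_app; apply: within_subset => s [Bs st].
by split => //; apply: BA.
Qed.

Lemma rd_ext A f g : (forall t, A t -> f t = g t) ->
  rd_continuous T A f -> rd_continuous T A g.
Proof.
move=> fg [fr fl]; split=> t At tt.
  rewrite -fg//; apply: cvg_trans (fr t At tt); apply: near_eq_cvg.
  by rewrite near_withinE; apply: nearW => s; apply: fg.
have [l fl'] := fl t At tt; exists l; apply: cvg_trans fl'; apply: near_eq_cvg.
by rewrite near_withinE; apply: nearW => s [As _]; apply: fg.
Qed.

Lemma rd_cvg A f : (forall t, A t -> f s @[s --> within A (nbhs t)] --> f t) ->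
  rd_continuous T A f.
Proof.
move=> fc; split=> t At _; first exact: fc.
exists (f t); apply: cvg_trans (fc t At); apply: cvg_app.
by apply: within_subset => s [].
Qed.

Lemma rd_continuousD A f g : rd_continuous T A f -> rd_continuous T A g ->
  rd_continuous T A (fun t => f t + g t).
Proof.
move=> [fr fl] [gr gl]; split=> t At tt; first by apply: cvgD; [apply: fr|apply: gr].
have [l ?] := fl t At tt; have [m ?] := gl t At tt.
by exists (l + m); apply: cvgD.
Qed.

Lemma rd_continuousM A f g : rd_continuous T A f -> rd_continuous T A g ->
  rd_continuous T A (fun t => f t * g t).
Proof.
move=> [fr fl] [gr gl]; split=> t At tt; first by apply: cvgM; [apply: fr|apply: gr].
have [l ?] := fl t At tt; have [m ?] := gl t At tt.
by exists (l * m); apply: cvgM.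
Qed.

Lemma rd_continuous_cst A c : rd_continuous T A (cst c).
Proof. by apply: rd_cvg => t _; apply: cvg_cst. Qed.

Lemma rd_continuous_norm A f : rd_continuous T A f ->
  rd_continuous T A (fun t => `|f t|).
Proof.
move=> [fr fl]; split=> t At tt; first by apply: cvg_norm; apply: fr.
by have [l ?] := fl t At tt; exists `|l|; apply: cvg_norm.
Qed.

Lemma rantideriv_rd a b f F : rantideriv a b f F ->
  rd_continuous T (ts_itv T `[a, b]) F.
Proof. by move=> Ff; apply: rd_cvg => t At; apply: rantideriv_cvg Ff At. Qed.

Lemma mu_cvg0_left t : T t -> mu T s @[s --> ts_left t] --> 0.
Proof.
move=> Tt; apply/cvgrPdist_le => e e0; rewrite near_withinE.
apply/near_realP; exists e => // s es _ [Ts st].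
have := sigma_ge s; have := sigma_le Tt st.
by rewrite sub0r normrN ler_norml /mu; lra.
Qed.

Lemma mu_cvg0 t : T t -> right_dense T t ->
  mu T s @[s --> within T (nbhs t)] --> 0.
Proof.
move=> Tt /right_denseP tt; apply/cvgrPdist_le => e e0; rewrite near_withinE.
have [u [Tu tu ue]] := sigma_approx t e0.
apply/near_realP; exists (Num.min e (u - t)); first by rewrite lt_min e0 subr_gt0.
move=> s; rewrite ltrBlDl addrC -!ltrBlDl !lt_min.
move=> /andP[es _] /andP[_ su] Ts.
have := sigma_ge s; rewrite sub0r normrN ler_norml /mu.
have [st|ts] := ltP s t.
  by have := sigma_le Tt st; lra.
by have := sigma_le Tu (ltac:(lra) : s < u); lra.
Qed.

(** The graininess is 0 at right-dense points and tends to 0 on approaching a left-dense point from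
    the left. There the denominator tends to 1 whatever the finite left limit of f, so the inverse
    converges. *)
Lemma rd_continuous_invmu A f : A `<=` T -> rd_continuous T A f ->
  (forall t, A t -> 1 + mu T t * f t != 0) ->
  rd_continuous T A (fun t => (1 + mu T t * f t)^-1).
Proof.
move=> AT [fr fl] f0; split=> t At tt.
  apply: cvgV; first exact: f0.
  have -> : 1 + mu T t * f t = 1 + 0 * f t.
    by rewrite /mu ((right_denseP t).1 tt) subrr.
  apply: cvgD; first exact: cvg_cst.
  apply: cvgM; last exact: fr.
  apply: cvg_trans (mu_cvg0 (AT _ At) tt); apply: cvg_app.
  exact: within_subset.
have [l fl'] := fl t At tt; exists (1 + 0 * l)^-1.
apply: cvgV; first by rewrite mul0r addr0 oner_neq0.
apply: cvgD; first exact: cvg_cst.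
apply: cvgM => //; apply: cvg_trans (mu_cvg0_left (AT _ At)); apply: cvg_app.
by apply: within_subset => s [As st]; split => //; apply: AT.
Qed.

(** * Increasing maps onto final segments *)

(** If g jumps to the right of t, the infimum of the values beyond t lies in the closed set B, so it
    is g r for some r > t, and monotonicity leaves no point of A strictly between t and r. A jump
    thus occurs only across a gap of A, where nothing has to be shown; the left side is symmetric.
    This yields continuity of the inverse delay, for which no derivative is given. *)
Lemma increasing_onto_cvg A B g : closed B ->
  (forall s t, A s -> A t -> s < t -> g s < g t) -> g @` A = B ->
  forall t, A t -> g s @[s --> within A (nbhs t)] --> g t.
Proof.
move=> Bcl ginc gAB t At; apply/cvgrPdist_le => e e0; rewrite near_withinE.
have gB s : A s -> B (g s) by move=> As; rewrite -gAB; exists s.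
have Bclosure (C : set R) : C `<=` B -> closure C `<=` B.
  by move=> CB x Cx; apply: Bcl; apply: closure_subset Cx.
have R1 : \forall s \near t, A s -> t < s -> g s - g t <= e.
  have [[s [As ts gse]]|ns] := pselect (exists s, [/\ A s, t < s & g s - g t <= e]).
    apply/near_realP; exists (s - t); first by rewrite subr_gt0.
    move=> r _ rs Ar tr; apply: le_trans gse; rewrite lerB// ltW//.
    by apply: ginc => //; lra.
  have ge s : A s -> t < s -> g t + e < g s.
    move=> As ts; rewrite ltNge; apply/negP => gse; apply: ns; exists s.
    by split => //; lra.
  pose C := g @` [set s | A s /\ t < s].
  have [[s [As ts]]|C0] := pselect (exists s, A s /\ t < s); last first.
    by near=> s => As ts; exfalso; apply: C0; exists s.
  have hC : has_inf C.
    by split; [exists (g s), s | exists (g t + e) => _ [r [Ar tr] <-]; apply/ltW/ge].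
  have : B (inf C).
    apply: (Bclosure C); first by move=> _ [r [Ar tr] <-]; apply: gB.
    move=> U /nbhs_ballP[d /= d0 dU]; have [_ [r [Ar tr] <-] rd] := inf_adherent d0 hC.
    exists (g r); split; first by exists r.
    apply: dU; rewrite /ball /= ltr_norml.
    have := ge_inf hC.2 (ex_intro2 _ _ r (conj Ar tr) erefl : C (g r)); lra.
  rewrite -gAB => -[r Ar gr].
  have gtr : g t + e <= g r.
    by rewrite gr; apply: lb_le_inf; [exact: hC.1|move=> _ [q [Aq tq] <-]; apply/ltW/ge].
  have tr : t < r.
    by rewrite ltNge le_eqVlt; apply/negP => /orP[/eqP rt|/(ginc _ _ Ar At)];
      [move: gtr; rewrite rt|]; lra.
  apply/near_realP; exists (r - t); first by rewrite subr_gt0.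
  move=> q _ qr Aq tq; exfalso.
  have : g q < g r by apply: ginc => //; lra.
  have := ge_inf hC.2 (ex_intro2 _ _ q (conj Aq tq) erefl : C (g q)); lra.
have L1 : \forall s \near t, A s -> s < t -> g t - g s <= e.
  have [[s [As ts gse]]|ns] := pselect (exists s, [/\ A s, s < t & g t - g s <= e]).
    apply/near_realP; exists (t - s); first by rewrite subr_gt0.
    move=> r rs _ Ar tr; apply: le_trans gse; rewrite lerB// ltW//.
    by apply: ginc => //; lra.
  have ge s : A s -> s < t -> g s < g t - e.
    move=> As ts; rewrite ltNge; apply/negP => gse; apply: ns; exists s.
    by split => //; lra.
  pose C := g @` [set s | A s /\ s < t].
  have [[s [As ts]]|C0] := pselect (exists s, A s /\ s < t); last first.
    by near=> s => As ts; exfalso; apply: C0; exists s.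
  have hC : has_sup C.
    by split; [exists (g s), s | exists (g t - e) => _ [r [Ar tr] <-]; apply/ltW/ge].
  have : B (sup C).
    apply: (Bclosure C); first by move=> _ [r [Ar tr] <-]; apply: gB.
    by apply: closure_sup; [exact: hC.1|exact: hC.2].
  rewrite -gAB => -[r Ar gr].
  have gtr : g r <= g t - e.
    by rewrite gr; apply: ge_sup; [exact: hC.1|move=> _ [q [Aq tq] <-]; apply/ltW/ge].
  have tr : r < t.
    by rewrite ltNge le_eqVlt; apply/negP => /orP[/eqP rt|/(ginc _ _ At Ar)];
      [move: gtr; rewrite -rt|]; lra.
  apply/near_realP; exists (t - r); first by rewrite subr_gt0.
  move=> q qr _ Aq tq; exfalso.
  have : g r < g q by apply: ginc => //; lra.
  have := ub_le_sup hC.2 (ex_intro2 _ _ q (conj Aq tq) erefl : C (g q)); lra.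
near=> s => As; have [st|ts|->] := ltgtP s t; last by rewrite subrr normr0 ltW.
- have := ginc _ _ As At st; have : g t - g s <= e.
    by move: st; move: As; near: s.
  by rewrite ler_norml; lra.
- have := ginc _ _ At As ts; have : g s - g t <= e.
    by move: ts; move: As; near: s.
  by rewrite ler_norml; lra.
Unshelve. all: by end_near. Qed.

Section IncreasingOnto.
Variables (c d : R) (g : R -> R).
Hypotheses (g_incr : forall s t, T s -> T t -> c <= s -> s < t -> g s < g t)
  (g_onto : g @` ts_itv T `[c, +oo[ = ts_itv T `[d, +oo[).

Lemma onto_in t : T t -> c <= t -> ts_itv T `[d, +oo[ (g t).
Proof. by move=> Tt ct; rewrite -g_onto; exists t => //; apply/ts_itvcy. Qed.

Lemma onto_T t : T t -> c <= t -> T (g t).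
Proof. by move=> Tt ct; have [] := onto_in Tt ct. Qed.

Lemma onto_le s t : T s -> T t -> c <= s -> s <= t -> g s <= g t.
Proof.
move=> Ts Tt cs; rewrite le_eqVlt => /orP[/eqP ->//|st]; exact/ltW/g_incr.
Qed.

Lemma onto_cvg t : T t -> c <= t ->
  g s @[s --> within (ts_itv T `[c, +oo[) (nbhs t)] --> g t.
Proof.
move=> Tt ct; apply: (@increasing_onto_cvg _ (ts_itv T `[d, +oo[)) => //.
- by apply: closedI => //; apply: interval_closed.
- by move=> r s /ts_itvcy[? ?] /ts_itvcy[? ?]; apply: g_incr.
- exact/ts_itvcy.
Qed.

(** Surjectivity gives a preimage of the end of each right neighbourhood of g t. At a
    right-scattered t the statement amounts to g (sigma t) = sigma (g t). *)
Lemma onto_right t : T t -> c <= t -> g s @[s --> ts_right t] --> ts_right (g t).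
Proof.
move=> Tt ct U [u [Tu tu] uU].
have : ts_itv T `[d, +oo[ u.
  by apply/ts_itvcy; split => //; have /ts_itvcy[] := onto_in Tt ct; lra.
rewrite -g_onto => -[v /ts_itvcy[Tv cv] gv].
exists v; first split => //.
  by rewrite ltNge; apply/negP => /(onto_le Tv Tt cv); rewrite gv leNgt tu.
move=> s Ts ts sv; apply: uU; first by apply: onto_T => //; lra.
  exact: g_incr.
by rewrite -gv; apply: onto_le => //; lra.
Qed.

Lemma onto_left t : T t -> c < t -> g s @[s --> ts_left t] --> ts_left (g t).
Proof.
move=> Tt ct U; rewrite /ts_left /= !near_simpl near_withinE => /near_realP[e e0 eU].
have /cvgrPdist_lt/(_ e e0) := onto_cvg Tt (ltW ct); rewrite near_withinE.
move=> /near_realP[k k0 kg].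
change (\forall s \near within [set s | T s /\ s < t] (nbhs t), U (g s)).
rewrite near_withinE.
apply/near_realP; exists (Num.min k (t - c)); first by rewrite lt_min k0 subr_gt0.
move=> s; rewrite ltrBlDl addrC -ltrBlDl lt_min => /andP[sk sc] _ [Ts st].
have cs : c <= s by lra.
have := kg s ltac:(lra) ltac:(lra) ((ts_itvcy _ _).2 (conj Ts cs)).
have := g_incr Ts Tt cs st; rewrite ltr_norml => ? /andP[? ?].
by apply: eU; [lra|lra|split => //; apply: onto_T].
Qed.

Lemma rd_continuous_comp f : rd_continuous T T f ->
  rd_continuous T (ts_itv T `[c, +oo[) (fun t => f (g t)).
Proof.
move=> [fr fl]; split=> t /ts_itvcy[Tt ct] tt.
  have gtt : right_dense T (g t).
    apply/right_denseP; apply/eqP; rewrite eq_le sigma_ge andbT.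
    apply/ler_addgt0Pr => e e0.
    have /cvgrPdist_le/(_ e e0) := onto_cvg Tt ct; rewrite near_withinE.
    move=> /near_realP[k k0 kg].
    have [s [Ts ts sk]] := sigma_approx t k0.
    rewrite ((right_denseP t).1 tt) in sk.
    have As : ts_itv T `[c, +oo[ s by apply/ts_itvcy; split => //; lra.
    have := kg s ltac:(lra) ltac:(lra) As; rewrite ler_norml.
    have := sigma_le (onto_T Ts ltac:(lra)) (g_incr Tt Ts ct ts).
    lra.
  apply: cvg_comp (fr _ (onto_T Tt ct) gtt) => U UT.
  have H : \forall s \near within (ts_itv T `[c, +oo[) (nbhs t), T (g s) -> U (g s).
    exact: onto_cvg Tt ct _ UT.
  change (\forall s \near within (ts_itv T `[c, +oo[) (nbhs t), U (g s)).
  move: H; rewrite !near_withinE; apply: filterS => s HU As.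
  by apply: HU => //; have /ts_itvcy[Ts cs] := As; apply: onto_T.
move: ct; rewrite le_eqVlt => /orP[/eqP ct|ct].
  (* At the left end t = c no point of the domain lies to the left, so every number is a left
     limit. *)
  exists 0 => U U0.
  change (\forall s \near within [set s | ts_itv T `[c, +oo[ s /\ s < t] (nbhs t),
    U (f (g s))).
  rewrite near_withinE.
  by near=> s => -[/ts_itvcy[Ts cs] st]; exfalso; lra.
have gtt : left_dense T (g t).
  apply/left_denseP => e e0.
  have /cvgrPdist_lt/(_ e e0) := onto_cvg Tt (ltW ct); rewrite near_withinE.
  move=> /near_realP[k k0 kg].
  have k'0 : 0 < Num.min k (t - c) by rewrite lt_min k0 subr_gt0.
  have [r [Tr]] := (left_denseP t).2 tt _ k'0.
  rewrite ltrBlDl addrC -ltrBlDl lt_min => /andP[rk rs] rt.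
  have Ar : ts_itv T `[c, +oo[ r by apply/ts_itvcy; split => //; lra.
  have := kg r ltac:(lra) ltac:(lra) Ar; rewrite ltr_norml => /andP[_ ?].
  exists (g r); split; [by apply: onto_T => //; lra|lra|].
  by apply: g_incr => //; lra.
have [l fl'] := fl _ (onto_T Tt (ltW ct)) gtt; exists l.
apply: (@cvg_trans _ (f (g s) @[s --> ts_left t])).
  apply: cvg_app; apply: within_subset => s [/ts_itvcy[]] //.
exact: cvg_comp (onto_left Tt ct) fl'.
Unshelve. all: by end_near. Qed.

Lemma lcont_comp F t : T t -> c < t -> lcont F (g t) -> lcont (fun s => F (g s)) t.
Proof. by move=> Tt ct Ft; apply: cvg_comp (onto_left Tt ct) Ft. Qed.

(** The chain rule keeps its classical form because g s - g t is nonzero for s > t and g carries the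
    right filter at t to the right filter at g t. *)
Lemma rderiv_comp F t l m : T t -> c <= t -> rderiv g t l -> rderiv F (g t) m ->
  rderiv (fun s => F (g s)) t (m * l).
Proof.
move=> Tt ct gl Fm.
have Fgm : (F (g s) - F (g t)) / (g s - g t) @[s --> ts_right t] --> m.
  exact: (@cvg_comp _ _ _ g (fun r => (F r - F (g t)) / (r - g t)) _ _ _
    (onto_right Tt ct) Fm).
apply: (cvg_trans _ (cvgM Fgm gl)); apply: near_eq_cvg; near=> s.
have ts : t < s by near: s; apply: ts_right_gt.
have Ts : T s by near: s; apply: ts_right_in.
have gs : 0 < g s - g t by rewrite subr_gt0; apply: g_incr.
by rewrite /= mulrA divfK// gt_eqF.
Unshelve. all: by end_near. Qed.

End IncreasingOnto.

(** * Exponential estimates *)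

Lemma cvg_expRN (F : set_system R) (f : R -> R) l : Filter F -> f s @[s --> F] --> l ->
  expR (- f s) @[s --> F] --> expR (- l).
Proof.
move=> FF fl; apply: (@cvg_comp _ _ _ (fun s => - f s) expR _ (nbhs (- l))).
  exact: cvgN.
exact: continuous_expR.
Qed.

(* The inequality 1 + y <= expR y makes both lemmas insensitive to whether a
   point is right-dense or right-scattered. *)
Lemma exp_decay a b (V q Q : R -> R) : T a -> T b -> a <= b ->
  rantideriv a b Q q ->
  (forall t, T t -> a < t -> t <= b -> lcont V t) ->
  (forall t, T t -> a <= t -> t < b ->
     0 <= V t /\ exists2 v, rderiv V t v & v <= Q t * V t) ->
  V b <= V a * expR (q b - q a).
Proof.
move=> Ta Tb ab [qr ql] Vl Vr.
suff H : V b * expR (- q b) <= V a * expR (- q a).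
  have -> : V b = V b * expR (- q b) * expR (q b).
    by rewrite -mulrA -expRD addNr expR0 mulr1.
  by rewrite [q b - q a]addrC expRD mulrA ler_pM2r ?expR_gt0.
apply: (@ts_nonincreasing (fun s => V s * expR (- q s))) => //.
  move=> t Tt at_ tb; apply: lcontM; first exact: Vl.
  exact: cvg_expRN (ql t Tt at_ tb).
move=> t Tt at_ tb e e0; have [Vt0 [v Vv vQ]] := Vr t Tt at_ tb.
have qt := qr t Tt at_ tb.
have qs := rderiv_cvg_sigma qt.
(* [K] bounds [expR (- q s)] for s close to t along the right filter, where the limit is the value
   at [sigma T t]; [k] is chosen so that the accumulated errors amount to e. *)
pose K := expR (- q (sigma T t)) + 1.
have K0 : 0 < K by rewrite /K ltr_pwDr// expR_ge0.
have [k k0 ke] : exists2 k, 0 < k & k * ((1 + V t) * K) = e.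
  have D0 : 0 < (1 + V t) * K by rewrite mulr_gt0// ltr_pwDl.
  by exists (e / ((1 + V t) * K)); rewrite ?divr_gt0// divfK// gt_eqF.
near=> s.
have ts : 0 < s - t by rewrite subr_gt0; near: s; apply: ts_right_gt.
have : `|V s - V t - v * (s - t)| <= k * (s - t).
  by near: s; apply: (rderivP _ _ _).1.
have : `|q s - q t - Q t * (s - t)| <= k * (s - t).
  by near: s; apply: (rderivP _ _ _).1.
have EK : expR (- q s) <= K.
  near: s; apply: (cvgr_le (expR (- q (sigma T t)))); last by rewrite /K ltrDl.
  exact: cvg_expRN.
rewrite !ler_norml => /andP[q1 _] /andP[_ V1].
have E0 := expR_gt0 (- q s).
have Et : (1 + (q s - q t)) * expR (- q s) <= expR (- q t).
  have -> : expR (- q t) = expR (q s - q t) * expR (- q s).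
    by rewrite -expRD; congr expR; ring.
  by rewrite ler_pM2r// expR_ge1Dx.
(* Nonnegativity of V t enters here: the inequality 1 + y <= expR y may be multiplied by V t
   whatever the sign of 1 + y. *)
have H1 : V t * ((1 + (q s - q t)) * expR (- q s)) <= V t * expR (- q t).
  by rewrite ler_wpM2l.
have H2 : V t * ((Q t - k) * (s - t)) <= V t * (q s - q t).
  by rewrite ler_wpM2l//; lra.
have H3 : v * (s - t) <= Q t * V t * (s - t) by rewrite ler_pM2r.
have H4 : V s - V t - V t * (q s - q t) <= k * (1 + V t) * (s - t) by lra.
have H5 : (V s - V t - V t * (q s - q t)) * expR (- q s) <=
    k * (1 + V t) * (s - t) * expR (- q s) by rewrite ler_pM2r.
have H6 : k * (1 + V t) * (s - t) * expR (- q s) <= k * (1 + V t) * (s - t) * K.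
  by rewrite ler_wpM2l// !mulr_ge0// ?ltW// ltr_pwDl.
have H7 : k * (1 + V t) * (s - t) * K = e * (s - t) by rewrite -ke; ring.
lra.
Unshelve. all: by end_near. Qed.

Lemma exp_growth a b (x p r A j J : R -> R) : T a -> T b -> a <= b ->
  rantideriv a b p A -> rantideriv a b j J ->
  rantideriv a b (fun t => p t * x t + r t) x ->
  (forall t, T t -> a <= t -> t < b -> 0 < 1 + mu T t * p t) ->
  (forall t, T t -> a <= t -> t < b ->
     `|r t| / (1 + mu T t * p t) * expR (- A t) <= j t) ->
  `|x b| * expR (- A b) <= `|x a| * expR (- A a) + (J b - J a).
Proof.
move=> Ta Tb ab [Ar Al] [Jr Jl] [xr xl] p0 rj.
suff : `|x b| * expR (- A b) - J b <= `|x a| * expR (- A a) - J a by lra.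
apply: (@ts_nonincreasing (fun s => `|x s| * expR (- A s) - J s)) => //.
  move=> t Tt at_ tb; apply: lcontB; last exact: Jl.
  apply: lcontM; first by apply: cvg_norm; apply: xl.
  exact: cvg_expRN (Al t Tt at_ tb).
move=> t Tt at_ tb e e0.
have At := Ar t Tt at_ tb; have Jt := Jr t Tt at_ tb; have xt := xr t Tt at_ tb.
have As := rderiv_cvg_sigma At.
have EAs : expR (- A s) @[s --> ts_right t] --> expR (- A (sigma T t)).
  exact: cvg_expRN.
pose K := expR (- A (sigma T t)) + 1.
have K0 : 0 < K by rewrite /K ltr_pwDr// expR_ge0.
have [k k0 ke] : exists2 k, 0 < k & k * ((`|x t| + 1) * K + 2) = e.
  have D0 : 0 < (`|x t| + 1) * K + 2.
    by rewrite ltr_wpDl// mulr_ge0// ?ltW// ltr_wpDl.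
  by exists (e / ((`|x t| + 1) * K + 2)); rewrite ?divr_gt0// divfK// gt_eqF.
have p1 := p0 t Tt at_ tb.
(* The weight 1 / (1 + mu p) on the forcing term originates here: A (sigma t) = A t + mu p and expR
   (- mu p) <= 1 / (1 + mu p). *)
have rE : `|r t| * expR (- A (sigma T t)) <= j t.
  apply: le_trans (rj t Tt at_ tb); rewrite -mulrA ler_wpM2l//.
  rewrite (rderiv_sigma At) opprD expRD mulrC ler_pM2r ?expR_gt0//.
  rewrite expRN lef_pV2 ?posrE ?expR_gt0// [p t * _]mulrC.
  exact: expR_ge1Dx.
near=> s.
have ts : 0 < s - t by rewrite subr_gt0; near: s; apply: ts_right_gt.
have : `|x s - x t - (p t * x t + r t) * (s - t)| <= k * (s - t).
  by near: s; apply: (rderivP _ _ _).1.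
have : `|A s - A t - p t * (s - t)| <= k * (s - t).
  by near: s; apply: (rderivP _ _ _).1.
have : `|J s - J t - j t * (s - t)| <= k * (s - t).
  by near: s; apply: (rderivP _ _ _).1.
have EK : expR (- A s) <= K.
  by near: s; apply: (cvgr_le _ EAs); rewrite /K ltrDl.
have rK : `|r t| * expR (- A s) <= j t + k.
  near: s; apply: (cvgr_le (`|r t| * expR (- A (sigma T t)))); last lra.
  by apply: cvgM => //; apply: cvg_cst.
(* Positivity of 1 + mu p persists along the right filter, so this factor can leave the absolute
   value in [X1]. *)
have ps : 0 < 1 + p t * (s - t).
  near: s; apply: (cvgr_gt (1 + p t * mu T t)); last by rewrite mulrC.
  apply: cvgD; first exact: cvg_cst.
  apply: cvgM; first exact: cvg_cst.
  by apply: cvgB; [apply: ts_right_cvg | apply: cvg_cst].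
move=> /ler_normlP[J1 J2] /ler_normlP[A1 A2] xs.
have E0 := expR_gt0 (- A s).
have E1 : (1 + (A s - A t)) * expR (- A s) <= expR (- A t).
  have -> : expR (- A t) = expR (A s - A t) * expR (- A s).
    by rewrite -expRD; congr expR; ring.
  by rewrite ler_pM2r// expR_ge1Dx.
have X1 : `|x s| <= `|x t| * (1 + p t * (s - t)) + `|r t| * (s - t) + k * (s - t).
  rewrite [x s](_ : _ = x t * (1 + p t * (s - t)) + r t * (s - t) +
    (x s - x t - (p t * x t + r t) * (s - t))); last ring.
  rewrite (le_trans (ler_normD _ _))// lerD//.
  by rewrite (le_trans (ler_normD _ _))// !normrM (gtr0_norm ps) (gtr0_norm ts).
have X2 : `|x s| * expR (- A s) <= (`|x t| * (1 + p t * (s - t)) +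
    `|r t| * (s - t) + k * (s - t)) * expR (- A s) by rewrite ler_pM2r.
have X3 : `|x t| * ((1 + p t * (s - t)) * expR (- A s)) <=
          `|x t| * (expR (- A t) + k * (s - t) * expR (- A s)).
  rewrite ler_wpM2l//.
  have : (1 + p t * (s - t)) * expR (- A s) <=
         (1 + (A s - A t) + k * (s - t)) * expR (- A s) by rewrite ler_pM2r//; lra.
  lra.
have X4 : `|r t| * expR (- A s) * (s - t) <= (j t + k) * (s - t) by rewrite ler_pM2r.
have X5 : k * (`|x t| + 1) * (s - t) * expR (- A s) <= k * (`|x t| + 1) * (s - t) * K.
  by rewrite ler_wpM2l// !mulr_ge0// ?ltW// ltr_wpDl.
have X6 : k * (`|x t| + 1) * (s - t) * K = e * (s - t) - 2 * k * (s - t).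
  by rewrite -ke; ring.
lra.
Unshelve. all: by end_near. Qed.

(** * Gluing rd-continuous functions on adjacent intervals *)

Lemma cvg_within_local A B f t l : (\forall s \near t, B s -> A s) ->
  f s @[s --> within A (nbhs t)] --> l -> f s @[s --> within B (nbhs t)] --> l.
Proof.
move=> BA fA U Ul; have := fA U Ul.
change ((\forall s \near within A (nbhs t), U (f s)) ->
  (\forall s \near within B (nbhs t), U (f s))).
rewrite !near_withinE; apply: filterS2 BA => s BA AU /BA; exact: AU.
Qed.

Lemma cvg_within_setU A B f t l : f s @[s --> within A (nbhs t)] --> l ->
  f s @[s --> within B (nbhs t)] --> l -> f s @[s --> within (A `|` B) (nbhs t)] --> l.
Proof.
move=> fA fB U Ul; have := fB U Ul; have := fA U Ul.
change ((\forall s \near within A (nbhs t), U (f s)) ->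
  (\forall s \near within B (nbhs t), U (f s)) ->
  (\forall s \near within (A `|` B) (nbhs t), U (f s))).
by rewrite !near_withinE; apply: filterS2 => s AU BU [/AU|/BU].
Qed.

Lemma near_lt t u : t < u -> \forall s \near t, s < u.
Proof. by move=> tu; apply/near_realP; exists (u - t) => [|s]; lra. Qed.

Lemma near_gt t u : u < t -> \forall s \near t, u < s.
Proof. by move=> ut; apply/near_realP; exists (t - u) => [|s]; lra. Qed.

Lemma rd_glue p m c f : T m -> p <= m -> m <= c ->
  rd_continuous T (ts_itv T `[p, m]) f -> rd_continuous T (ts_itv T `[m, c]) f ->
  rd_continuous T (ts_itv T `[p, c]) f.
Proof.
move=> Tm pm mc [f1r f1l] [f2r f2l].
have L t : t < m -> \forall s \near t, ts_itv T `[p, c] s -> ts_itv T `[p, m] s.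
  move=> tm; have := near_lt tm; apply: filterS => s sm /ts_itvcc[Ts ps _].
  by apply/ts_itvcc; split => //; lra.
have G t : m < t -> \forall s \near t, ts_itv T `[p, c] s -> ts_itv T `[m, c] s.
  move=> tm; have := near_gt tm; apply: filterS => s sm /ts_itvcc[Ts ps sc].
  by apply/ts_itvcc; split => //; lra.
split=> t /ts_itvcc[Tt pt tc] tt.
  have [tm|mt|tm] := ltgtP t m.
  - by apply: cvg_within_local (L t tm) _; apply: f1r => //; apply/ts_itvcc; split => //; lra.
  - by apply: cvg_within_local (G t mt) _; apply: f2r => //; apply/ts_itvcc; split => //; lra.
  - apply: (@cvg_within_local (ts_itv T `[p, m] `|` ts_itv T `[m, c])).
      apply/near_realP; exists 1 => // s _ _ /ts_itvcc[Ts ps sc]; have [sm|ms] := leP s m.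
        by left; apply/ts_itvcc.
      by right; apply/ts_itvcc; split => //; lra.
    apply: cvg_within_setU; [apply: f1r|apply: f2r] => //;
      by apply/ts_itvcc; split => //; lra.
have [tm|mt] := leP t m.
  have [|l fl] := f1l t _ tt; first by apply/ts_itvcc.
  exists l; apply: cvg_within_local fl; apply/near_realP; exists 1 => // s _ _ [/ts_itvcc[Ts ps sc] st].
  by split => //; apply/ts_itvcc; split => //; lra.
have [|l fl] := f2l t _ tt; first by apply/ts_itvcc; split => //; lra.
exists l; apply: cvg_within_local fl; have := G t mt; apply: filterS => s H [Bs st].
by split => //; apply: H.
Qed.

(** * The Lyapunov functional *)

(** With k the mean of f over [s, u], the difference of the two sides is u - s times the integral of
    (f - k) ^ 2. *)
Lemma cauchy_schwarz s u f w F W : T s -> T u -> s < u ->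
  rantideriv s u f F -> rantideriv s u w W ->
  (forall t, T t -> s <= t -> t < u -> w t = f t ^+ 2) ->
  (F u - F s) ^+ 2 <= (u - s) * (W u - W s).
Proof.
move=> Ts Tu su [Fr Fl] [Wr Wl] wf.
have su0 : 0 < u - s by rewrite subr_gt0.
pose k := (F u - F s) / (u - s).
have kE : k * (u - s) = F u - F s by rewrite /k divfK// gt_eqF.
pose G t := W t - 2 * k * F t + k ^+ 2 * t.
have Gg : rantideriv s u (fun t => w t - 2 * k * f t + k ^+ 2 * 1) G.
  split=> t Tt st tu.
    apply: rderivD; last by apply: rderivZ; apply: rderiv_id.
    by apply: rderivB; [apply: Wr|apply: rderivZ; apply: Fr].
  apply: lcontD; last by apply: lcontM; [apply: lcont_cst|apply: lcont_id].
  by apply: lcontB; [apply: Wl|apply: lcontM; [apply: lcont_cst|apply: Fl]].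
have := rantideriv_ge Ts Tu (ltW su) Gg (k := 0).
rewrite mul0r => /(_ _)H; have {}H : 0 <= G u - G s.
  apply: H => t Tt st tu; rewrite wf//.
  rewrite (_ : _ + _ = (f t - k) ^+ 2) ?sqr_ge0//; ring.
rewrite -subr_ge0 -kE.
have -> : (u - s) * (W u - W s) - (k * (u - s)) ^+ 2 = (u - s) * (G u - G s).
  have -> : G u - G s = W u - W s - 2 * k * (F u - F s) + k ^+ 2 * (u - s).
    by rewrite /G; ring.
  by rewrite -kE; ring.
by rewrite mulr_ge0// ltW.
Qed.

Section Delay.
Variables (t0 : R) (g gi g' a b x : R -> R) (lambda : R).
Hypotheses (Tt0 : T t0)
  (g_incr : forall s t, T s -> T t -> t0 <= s -> s < t -> g s < g t)
  (g_onto : g @` ts_itv T `[t0, +oo[ = ts_itv T `[g t0, +oo[)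
  (g_lt : forall t, T t -> t0 <= t -> g t < t)
  (g_deriv : forall t, T t -> t0 <= t -> rderiv g t (g' t))
  (gi_g : forall t, T t -> t0 <= t -> gi (g t) = t).

(** The inverse delay is again increasing and onto a final segment, so the results on such maps
    apply to it from g t0 on and make b (gi s) rd-continuous. *)
Lemma delay_inv_incr s t : T s -> T t -> g t0 <= s -> s < t -> gi s < gi t.
Proof.
move=> Ts Tt ss st.
have : ts_itv T `[g t0, +oo[ s by apply/ts_itvcy.
have : ts_itv T `[g t0, +oo[ t by apply/ts_itvcy; split => //; lra.
rewrite -g_onto => -[v /ts_itvcy[Tv tv] vt] [u /ts_itvcy[Tu tu] us].
rewrite -vt -us !gi_g//; rewrite ltNge; apply/negP => /(onto_le g_incr Tv Tu tv).
lra.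
Qed.

Lemma delay_inv_onto : gi @` ts_itv T `[g t0, +oo[ = ts_itv T `[t0, +oo[.
Proof.
rewrite -g_onto; apply/seteqP; split.
  by move=> _ [_ [u /ts_itvcy[Tu tu] <-] <-]; rewrite gi_g//; apply/ts_itvcy.
move=> u ut; have /ts_itvcy[Tu tu] := ut.
by exists (g u); [exists u | rewrite gi_g].
Qed.

Lemma delay_deriv_ge0 t : T t -> t0 <= t -> 0 <= g' t.
Proof.
move=> Tt tt; apply: (cvgr_to_ge (g_deriv Tt tt)).
near=> s; have Ts : T s by near: s; apply: ts_right_in.
have ts : t < s by near: s; apply: ts_right_gt.
by rewrite divr_ge0// subr_ge0 ltW//; apply: g_incr.
Unshelve. all: by end_near. Qed.

Lemma T_delay t : T t -> t0 <= t -> T (g t).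
Proof. by move=> Tt tt; apply: (onto_T g_onto). Qed.

Lemma delay_ge t : T t -> t0 <= t -> g t0 <= g t.
Proof. by move=> Tt tt; apply: (onto_le g_incr). Qed.

Hypotheses (b_rd : rd_continuous T T b)
  (x_rd : rd_continuous T (ts_itv T `[g t0, t0]) x)
  (x_deriv : forall t, T t -> t0 <= t ->
     rderiv x t (a t * x t + b t * x (g t) * g' t))
  (x_lcont : forall t, T t -> t0 < t -> lcont x t).

Lemma solution_rd c : t0 <= c -> rd_continuous T (ts_itv T `[g t0, c]) x.
Proof.
move=> tc; apply: (@rd_glue _ t0) => //; first exact/ltW/g_lt.
by apply: rantideriv_rd; split=> t Tt tt _; [apply: x_deriv|apply: x_lcont].
Qed.

Lemma delayed_coef_rd c : t0 <= c ->
  rd_continuous T (ts_itv T `[g t0, c]) (fun s => b (gi s)).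
Proof.
move=> tc; apply: (@rd_subset (ts_itv T `[g t0, +oo[)).
  by move=> s /ts_itvcc[? ? _]; apply/ts_itvcy.
exact: (rd_continuous_comp delay_inv_incr delay_inv_onto).
Qed.

Lemma solution_rd1 c : t0 <= c ->
  rd_continuous T (ts_itv T `[g t0, c]) (fun s => b (gi s) * x s).
Proof. by move=> tc; apply: rd_continuousM; [apply: delayed_coef_rd|apply: solution_rd]. Qed.

Lemma solution_rd2 c : t0 <= c ->
  rd_continuous T (ts_itv T `[g t0, c]) (fun s => b (gi s) ^+ 2 * x s ^+ 2).
Proof.
move=> tc; apply: (@rd_ext _ (fun s => (b (gi s) * x s) * (b (gi s) * x s))).
  by move=> s _; rewrite -expr2 exprMn.
by apply: rd_continuousM; apply: solution_rd1.
Qed.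

(** [F], [W] and [Z] stand for antiderivatives of b (gi s) * x s, of its square, and of [W]. The
    last factor is then the double integral, since the integral of W t - W s over s in [g t, t]
    equals W t * (t - g t) - (Z t - Z (g t)). *)
Definition lyapunov (F W Z : R -> R) t :=
  (x t + (F t - F (g t))) ^+ 2 + lambda * (W t * (t - g t) - (Z t - Z (g t))).

Lemma lyapunovE F W Z : lyapunov F W Z =
  (fun t => (x t + (F t - F (g t))) * (x t + (F t - F (g t))) +
            lambda * (W t * (t - g t) - (Z t - Z (g t)))).
Proof. by apply/funext => t; rewrite /lyapunov expr2. Qed.

Section Lyapunov.
Variables (c : R) (F W Z q : R -> R).
Let Q t := a t + b (gi t).
Let beta t := t - g t.
Hypotheses (Tc : T c) (t0c : t0 <= c) (lambda0 : 0 < lambda)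
  (Ff : rantideriv (g t0) c (fun s => b (gi s) * x s) F)
  (Ww : rantideriv (g t0) c (fun s => b (gi s) ^+ 2 * x s ^+ 2) W)
  (ZW : rantideriv (g t0) c W Z)
  (qQ : rantideriv t0 c Q q)
  (Q_ge : forall t, T t -> t0 <= t ->
     - (lambda * g' t / (beta t + lambda * (beta t + mu T t))) <= Q t)
  (Q_le : forall t, T t -> t0 <= t ->
     Q t <= - lambda * (beta t + mu T t) * b (gi t) ^+ 2 - mu T t * Q t ^+ 2).

Let W_le s u : T s -> T u -> g t0 <= s -> s <= u -> u <= c -> W s <= W u.
Proof.
move=> Ts Tu ss su uc; rewrite -subr_ge0.
have := rantideriv_ge Ts Tu su (rantideriv_sub ss uc Ww) (k := 0).
by rewrite mul0r; apply => t *; rewrite -exprMn sqr_ge0.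
Qed.

Let Z_le s u : T s -> T u -> g t0 <= s -> s <= u -> u <= c ->
  Z u - Z s <= W u * (u - s).
Proof.
move=> Ts Tu ss su uc; apply: (rantideriv_le Ts Tu su (rantideriv_sub ss uc ZW)).
by move=> t Tt st tu; apply: W_le => //; lra.
Qed.

Let Z_ge s u : T s -> T u -> g t0 <= s -> s <= u -> u <= c ->
  W s * (u - s) <= Z u - Z s.
Proof.
move=> Ts Tu ss su uc; apply: (rantideriv_ge Ts Tu su (rantideriv_sub ss uc ZW)).
by move=> t Tt st tu; apply: W_le => //; lra.
Qed.

Let I_le t : T t -> t0 <= t -> t <= c ->
  (F t - F (g t)) ^+ 2 <= beta t * (W t - W (g t)).
Proof.
move=> Tt tt tc; have gt := delay_ge Tt tt; have Tg := T_delay Tt tt.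
apply: (cauchy_schwarz Tg Tt (g_lt Tt tt) (rantideriv_sub gt tc Ff)
  (rantideriv_sub gt tc Ww)) => s _ _ _.
by rewrite exprMn.
Qed.

Let B t := W t * beta t - (Z t - Z (g t)).

(** The integrand W t - W s of the double integral is at least W t - W m on [g t, m] and nonnegative
    on [m, t]. *)
Let B_ge t m : T t -> T m -> t0 <= t -> t <= c -> g t <= m -> m <= t ->
  (W t - W m) * (m - g t) <= B t.
Proof.
move=> Tt Tm tt tc gm mt; have gt := delay_ge Tt tt; have Tg := T_delay Tt tt.
have := Z_le Tm Tt ltac:(lra) mt tc; have := Z_le Tg Tm gt gm ltac:(lra).
by rewrite /B /beta; lra.
Qed.

Let B_le t : T t -> t0 <= t -> t <= c -> B t <= beta t * (W t - W (g t)).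
Proof.
move=> Tt tt tc; have gt := delay_ge Tt tt; have Tg := T_delay Tt tt.
have := Z_ge Tg Tt gt (ltW (g_lt Tt tt)) tc.
by rewrite /B /beta; lra.
Qed.

Let B_ge0 t : T t -> t0 <= t -> t <= c -> 0 <= B t.
Proof.
move=> Tt tt tc.
have := B_ge Tt (T_delay Tt tt) tt tc (lexx _) (ltW (g_lt Tt tt)).
by rewrite subrr mulr0.
Qed.

Let Q_le0 t : T t -> t0 <= t -> Q t <= 0.
Proof.
move=> Tt tt; apply: le_trans (Q_le Tt tt) _; rewrite subr_le0.
have mu0 := mu_ge0 t; have gt := g_lt Tt tt.
have bm : 0 <= beta t + mu T t by rewrite /beta; lra.
apply: (@le_trans _ _ 0); last by rewrite mulr_ge0// sqr_ge0.
by rewrite !mulNr oppr_le0 mulr_ge0 ?sqr_ge0// mulr_ge0// ltW.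
Qed.

Let V := lyapunov F W Z.

Lemma lyapunov_ge0 t : T t -> t0 <= t -> t <= c -> 0 <= V t.
Proof.
move=> Tt tt tc; apply: addr_ge0; first exact: sqr_ge0.
by apply: mulr_ge0; [apply: ltW | apply: B_ge0].
Qed.

Lemma lyapunov_lcont t : T t -> t0 < t -> t <= c -> lcont V t.
Proof.
move=> Tt tt tc; have gt := delay_ge Tt (ltW tt); have Tg := T_delay Tt (ltW tt).
have gtt := g_lt Tt (ltW tt); have ggt := g_incr Tt0 Tt (lexx _) tt.
have comp H : lcont H (g t) -> lcont (fun s => H (g s)) t.
  exact: (lcont_comp g_incr g_onto Tt tt).
have gl := comp _ (@lcont_id (g t)).
have tt' : g t0 < t by lra.
have gc : g t <= c by lra.
have Fl := Ff.2 t Tt tt' tc; have Fgl := comp _ (Ff.2 _ Tg ggt gc).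
have Wl := Ww.2 t Tt tt' tc.
have Zl := ZW.2 t Tt tt' tc; have Zgl := comp _ (ZW.2 _ Tg ggt gc).
have Al : lcont (fun s => x s + (F s - F (g s))) t.
  by apply: lcontD; [apply: x_lcont|apply: lcontB].
have Bl : lcont (fun s => W s * (s - g s) - (Z s - Z (g s))) t.
  apply: lcontB; last exact: lcontB.
  exact: lcontM Wl (lcontB (@lcont_id t) gl).
rewrite /V lyapunovE.
exact: lcontD (lcontM Al Al) (lcontM (@lcont_cst lambda t) Bl).
Qed.

(** In V^Delta - Q V the products of x and I = F t - F (g t) cancel, and the upper bound on Q makes
    what remains of the x ^ 2 terms nonpositive. With D = W t - W (g t), both I ^ 2 and B t are at
    most beta * D; the lower bound on Q lets the loss - lambda * g' * D, produced by the moving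
    lower limit of the double integral, pay for - Q * (1 + lambda) * beta * D. *)
Lemma lyapunov_deriv t : T t -> t0 <= t -> t < c ->
  exists2 v, rderiv V t v & v <= Q t * V t.
Proof.
move=> Tt tt tc; have gt := delay_ge Tt tt; have Tg := T_delay Tt tt.
have gtt := g_lt Tt tt.
have comp H m : rderiv H (g t) m -> rderiv (fun s => H (g s)) t (m * g' t).
  exact: (rderiv_comp g_incr g_onto Tt tt (g_deriv Tt tt)).
have tt' : g t0 <= t by lra.
have gc : g t < c by lra.
have Fr := Ff.1 t Tt tt' tc; have Fgr := comp _ _ (Ff.1 _ Tg gt gc).
have Wr := Ww.1 t Tt tt' tc.
have Zr := ZW.1 t Tt tt' tc; have Zgr := comp _ _ (ZW.1 _ Tg gt gc).
have Ar : rderiv (fun s => x s + (F s - F (g s))) t (Q t * x t).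
  (* The delayed term of the equation is cancelled by the derivative of [F (g s)], because gi (g t)
     = t. *)
  have -> : Q t * x t = a t * x t + b t * x (g t) * g' t +
      (b (gi t) * x t - b (gi (g t)) * x (g t) * g' t) by rewrite gi_g// /Q; ring.
  exact: rderivD (x_deriv Tt tt) (rderivB Fr Fgr).
have br := rderivB (@rderiv_id t) (g_deriv Tt tt).
have := rderivD (rderivM Ar Ar) (rderivZ (c := lambda) (rderivB (rderivM Wr br) (rderivB Zr Zgr))).
set v := (X in rderiv _ t X) => Vv; exists v.
  by rewrite /V lyapunovE; exact: Vv.
rewrite /v {v Vv} (rderiv_sigma Ar).
have mu0 := mu_ge0 t.
have g'0 := delay_deriv_ge0 Tt tt.
have Il := I_le Tt tt (ltW tc); have Bl := B_le Tt tt (ltW tc).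
have Wd : 0 <= W t - W (g t) by rewrite subr_ge0; apply: W_le => //; lra.
have bt : 0 < beta t by rewrite /beta subr_gt0.
(* Hence the delay at [sigma T t] is at most beta t + mu t, the factor that appears in the upper
   bound on Q. *)
have gs : g t <= g (sigma T t).
  by apply: (onto_le g_incr) => //; [apply: sigma_in|apply: sigma_ge].
have Ql := Q_le Tt tt; have Qg := Q_ge Tt tt.
have D0 : 0 < beta t + lambda * (beta t + mu T t).
  by rewrite ltr_wpDr// mulr_ge0 ?ltW// ltr_wpDr.
have Q0 := Q_le0 Tt tt.
have Qd : - Q t * (beta t + lambda * (beta t + mu T t)) <= lambda * g' t.
  by rewrite -ler_pdivlMr// lerNl.
rewrite /V /lyapunov -/(B t) -/(beta t).
set I := F t - F (g t) in Il *.
set D := W t - W (g t) in Il Bl Wd.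
have X1 : Q t * x t ^+ 2 <= (- lambda * (beta t + mu T t) * b (gi t) ^+ 2
    - mu T t * Q t ^+ 2) * x t ^+ 2 by rewrite ler_wpM2r// sqr_ge0.
have X2 : - Q t * I ^+ 2 <= - Q t * (beta t * D) by rewrite ler_wpM2l// oppr_ge0.
have X3 : - Q t * (lambda * B t) <= - Q t * (lambda * (beta t * D)).
  by rewrite ler_wpM2l ?oppr_ge0// ler_pM2l.
have X4 : - Q t * (beta t + lambda * beta t) * D <= lambda * g' t * D.
  rewrite ler_wpM2r//; apply: le_trans Qd; rewrite ler_wpM2l ?oppr_ge0//.
  by rewrite lerD2l ler_pM2l// lerDl.
have X5 : lambda * (b (gi t) ^+ 2 * x t ^+ 2 * (sigma T t - g (sigma T t))) <=
          lambda * (b (gi t) ^+ 2 * x t ^+ 2 * (beta t + mu T t)).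
  rewrite ler_pM2l// ler_wpM2l//; first by rewrite -exprMn sqr_ge0.
  by rewrite /beta /mu; lra.
rewrite /D in X2 X3 X4; lra.
Qed.

Lemma lyapunov_decay s t : T s -> T t -> t0 <= s -> s <= t -> t <= c ->
  V t <= V s * expR (q t - q s) /\ V t <= V s.
Proof.
move=> Ts Tt ss st tc.
have qst := rantideriv_sub ss tc qQ.
have decay : V t <= V s * expR (q t - q s).
  apply: (exp_decay Ts Tt st qst) => u Tu su ut.
    by apply: lyapunov_lcont => //; lra.
  by split; [apply: lyapunov_ge0|apply: lyapunov_deriv] => //; lra.
split=> //; apply: le_trans decay _; rewrite ler_piMr ?lyapunov_ge0//; first lra.
rewrite -expR0 ler_expR.
rewrite -(mul0r (t - s)); apply: (rantideriv_le Ts Tt st qst) => u Tu su ut.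
by apply: Q_le0 => //; lra.
Qed.

(* The double integrals in V c and V m contain rectangles of width L with weights
   W c - W m and W m - W (g c), which add up to the whole weight on [g c, c]. *)
Lemma lyapunov_lower m : T m -> t0 <= m -> m <= c -> g c <= m ->
  let L := g c - g m in let xi := 1 + lambda * L / beta c in
  0 <= L -> L <= m - g c ->
  (1 - 1 / xi) * x c ^+ 2 <= 2 * V t0 * expR (q m - q t0).
Proof.
move=> Tm tm mc gm L xi L0 Lm.
have [Vm _] := lyapunov_decay Tt0 Tm (lexx _) tm mc.
have [_ Vc] := lyapunov_decay Tm Tc tm mc (lexx _).
have Tg := T_delay Tc t0c; have gc := delay_ge Tc t0c.
(* The factor 2 of the conclusion comes from V c <= V m. *)
suff H : (1 - 1 / xi) * x c ^+ 2 <= V c + V m.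
  by apply: le_trans H _; rewrite -mulrA; lra.
have b0 : 0 < beta c by rewrite subr_gt0 g_lt.
have B1 : L * (W c - W m) <= B c.
  apply: le_trans (B_ge Tc Tm t0c (lexx _) gm mc).
  by rewrite mulrC ler_wpM2l// subr_ge0 W_le//; lra.
(* At m the interval is cut at g c, whose distance to g m is exactly L; at c the cut was at m, at
   distance at least L from g c. *)
have B2 : L * (W m - W (g c)) <= B m.
  rewrite mulrC; apply: (B_ge Tm Tg) => //.
  by rewrite -subr_ge0.
have IW := I_le Tc t0c (lexx _).
set I := F c - F (g c) in IW.
pose k := lambda * L / beta c.
have k0 : 0 <= k by rewrite /k divr_ge0 ?(ltW b0)// mulr_ge0// ltW.
have kI : k * I ^+ 2 <= lambda * (L * (W c - W (g c))).
  have -> : lambda * (L * (W c - W (g c))) = k * (beta c * (W c - W (g c))).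
    by rewrite /k; field; rewrite gt_eqF.
  by rewrite ler_wpM2l.
have VB : (x c + I) ^+ 2 + k * I ^+ 2 <= V c + V m.
  have : 0 <= (x m + (F m - F (g m))) ^+ 2 by apply: sqr_ge0.
  have : lambda * (L * (W c - W m) + L * (W m - W (g c))) <= lambda * (B c + B m).
    by rewrite ler_pM2l// lerD.
  rewrite /V /lyapunov -/I -/(beta c) -/(beta m) -/(B c) -/(B m).
  lra.
apply: le_trans VB; rewrite -subr_ge0.
have x0 : 0 < xi by rewrite /xi -/k ltr_pwDl.
(* Completing the square: the minimum over I of (x + I) ^ 2 + k * I ^ 2 is k / (1 + k) * x ^ 2, and
   1 + k = xi. *)
have -> : (x c + I) ^+ 2 + k * I ^+ 2 - (1 - 1 / xi) * x c ^+ 2 =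
          (xi * I + x c) ^+ 2 / xi.
  have -> : k = xi - 1 by rewrite /xi -/k; ring.
  by field; rewrite gt_eqF.
by rewrite divr_ge0 ?sqr_ge0// ltW.
Qed.

End Lyapunov.
End Delay.

End TimeScaleCalculus.

(** * Consequences of the shift axioms *)

Section ShiftFacts.
Variables (R : realType) (T Tstar : set R) (t0 : R) (dm dp : partial_op R).
Hypothesis shift : shift_operators T Tstar t0 dm dp.
Implicit Types (s t : R).

Lemma shift_init_back t : Tstar t -> shift_dom T Tstar t0 dm (t0, t) /\ dm t0 t = t.
Proof.
move=> Tt; have [d e] := shift_P3r shift Tt.
by have := shift_P4p shift d; rewrite e.
Qed.

(** The shift by t0 is the identity, and backward shifts decrease in their first argument. *)
Lemma shift_back_lt s t : t0 < s -> shift_dom T Tstar t0 dm (s, t) -> dm s t < t.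
Proof.
move=> ts dst; have [_ /= Tt _ _] := dst; have [d0 e] := shift_init_back Tt.
by rewrite -[ltRHS]e; apply: (shift_P2m shift) d0 dst ts.
Qed.

(** The forward shift by s takes t0 to s, and the backward shift undoes it. *)
Lemma shift_back_self s : T s -> t0 <= s ->
  shift_dom T Tstar t0 dm (s, s) /\ dm s s = t0.
Proof.
move=> Ts ts; have [d e] := shift_P3l shift ((ts_itvcy _ _ _).2 (conj Ts ts)).
by have := shift_P4p shift d; rewrite e.
Qed.

End ShiftFacts.

Theorem theorem4 (R : realType) (T Tstar : set R) (t0 : R)
    (dm dp : partial_op R) (h : R) (dm' : R -> R) (M : R) (a b : R -> R)
    (lambda alpha : R) (psi x : R -> R) :
  let Q t := a t + b (dp h t) in
  let beta t := t - dm h t in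
  let Lambda t := dm h t - dm h (dm alpha t) in
  let xi t := 1 + lambda * Lambda t / beta t in
  let V0 :=
    (x t0 + delta_int T (dm h t0) t0 (fun s => b (dp h s) * x s)) ^+ 2
    + lambda * delta_int T (dm h t0) t0 (fun s =>
        delta_int T s t0 (fun u => b (dp h u) ^+ 2 * x u ^+ 2)) in
  let norm_psi := sup [set `|psi t| | t in ts_itv T `[dm h t0, t0]] in
  time_scale T ->
  ~ has_ubound T ->
  shift_operators T Tstar t0 dm dp ->
  delay_function T Tstar t0 dm dp h dm' ->
  0 <= t0 ->
  rd_continuous T T a ->
  rd_continuous T T b ->
  (forall t, ts_itv T `[t0, +oo[ t -> `|dm' t| <= M) ->
  pos_regressive T T a ->
  regressive T (ts_itv T `[t0, +oo[) Q ->
  0 < lambda ->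
  (forall t, ts_itv T `[t0, +oo[ t ->
    - (lambda * dm' t / (beta t + lambda * (beta t + mu T t))) <= Q t /\
    Q t <= - lambda * (beta t + mu T t) * b (dp h t) ^+ 2 - mu T t * Q t ^+ 2) ->
  ts_itv T `]t0, h[ alpha ->
  (forall t, ts_itv T `[t0, +oo[ t ->
    shift_dom T Tstar t0 dm (alpha, t) /\ shift_dom T Tstar t0 dp (alpha, t)) ->
  (forall t, ts_itv T `[alpha, +oo[ t ->
    dm h t <= (dm alpha t + dm h (dm alpha t)) / 2) ->
  rd_continuous T (ts_itv T `[dm h t0, t0]) psi ->
  is_solution T t0 dm h dm' a b psi x ->
  (forall t, ts_itv T `[alpha, +oo[ t ->
    1 < xi t /\
    `|x t| <= Num.sqrt (2 / (1 - 1 / xi t) * V0)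
              * expR (1 / 2 * delta_int T t0 (dm alpha t) Q)) /\
  (forall t, ts_itv T `[t0, alpha[ t ->
    `|x t| <= norm_psi * expR (delta_int T t0 t a)
      * (1 + M * delta_int T t0 t (fun s =>
           `|b s / (1 + mu T s * a s)| * expR (- delta_int T t0 s a)))).
Proof.
move=> Q beta Lambda xi V0 norm_psi [_ Tcl] Tub shift delay _ a_rd b_rd dM.
move=> [_ a_pos] [Q_rd _] lam0 Q_bounds /= alphaP alpha_dom alpha_mid psi_rd.
move=> [x_der x_psi].
have sub : ts_itv T `[t0, +oo[ `<=` T by move=> ? [].
have Tt0 : T t0 by apply: (shift_sub shift); apply: (shift_init shift).
have in0 t : T t -> t0 <= t -> ts_itv T `[t0, +oo[ t by move=> *; apply/ts_itvcy.
have nb0 t : T t -> t0 <= t -> ts_right T t (ts_itv T `[t0, +oo[).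
  move=> Tt tt; have [u Tu tu] := ts_gt Tub t; exists u => // s Ts ts _.
  by apply: in0 => //; lra.
have [Th th] : T h /\ t0 < h.
  by have [Th] := delay_h delay; rewrite /= in_itv /= andbT.
have [Ta [ta ah]] : T alpha /\ t0 < alpha /\ alpha < h.
  by case: alphaP => Ta; rewrite /= in_itv /= => /andP[].
have g_incr s t : T s -> T t -> t0 <= s -> s < t -> dm h s < dm h t.
  move=> Ts Tt ts st; apply: (delay_incr delay) => //; apply: in0 => //; lra.
have g_onto := delay_onto delay.
have g_lt t : T t -> t0 <= t -> dm h t < t.
  by move=> Tt tt; apply: (shift_back_lt shift th); have [] := delay_dom delay (in0 t Tt tt).
have g_deriv t : T t -> t0 <= t -> rderiv T (dm h) t (dm' t).
  move=> Tt tt; apply: (delta_deriv_rderiv Tcl Tub sub (in0 t Tt tt) (nb0 t Tt tt)).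
  exact: (delay_deriv delay) (in0 t Tt tt).
have gi_g t : T t -> t0 <= t -> dp h (dm h t) = t.
  by move=> Tt tt; apply: (delay_inv delay); apply: in0.
have Tg0 : T (dm h t0) := onto_T g_onto Tt0 (lexx _).
have g00 := g_lt t0 Tt0 (lexx _).
have x_rd : rd_continuous T (ts_itv T `[dm h t0, t0]) x.
  by apply: rd_ext psi_rd => t /x_psi.
have x_deriv t : T t -> t0 <= t ->
    rderiv T x t (a t * x t + b t * x (dm h t) * dm' t).
  move=> Tt tt; apply: (delta_deriv_rderiv Tcl Tub sub (in0 t Tt tt) (nb0 t Tt tt)).
  exact: x_der (in0 t Tt tt).
have x_lcont t : T t -> t0 < t -> lcont T x t.
  move=> Tt tt; apply: (delta_deriv_lcont (in0 t Tt (ltW tt)) _ (x_der t (in0 t Tt (ltW tt)))).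
  by have := near_gt tt; apply: filterS => s ts Ts _; apply: in0 => //; apply: ltW.
split.
- move=> t /ts_itvcy[Tt at_].
  have t0t : t0 <= t by lra.
  have [dma dmap] := alpha_dom t (in0 t Tt t0t).
  set m := dm alpha t.
  have Tm : T m by have [_ _ _ /(shift_sub shift)] := dma.
  have t0m : t0 <= m.
    (* Since dm alpha alpha = t0, monotonicity in the second argument keeps m at or above t0 for t
       >= alpha. *)
    have [daa aa] := shift_back_self shift Ta (ltW ta).
    rewrite /m -[leLHS]aa; move: at_; rewrite le_eqVlt => /orP[/eqP <- //|at_].
    by apply/ltW; apply: (shift_P1m shift) daa dma (lexx _) at_.
  have mt : m < t by apply: (shift_back_lt shift ta).
  have gm : dm h t < m.
    by apply: (shift_P2m shift) dma _ ah; have [] := delay_dom delay (in0 t Tt t0t).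
  have L0 : 0 < Lambda t by rewrite /Lambda subr_gt0 g_incr.
  have b0 : 0 < beta t by rewrite /beta subr_gt0 g_lt.
  have xi1 : 1 < xi t by rewrite /xi ltrDl divr_gt0// mulr_gt0.
  split=> //.
  have g0t : dm h t0 <= t by lra.
  have f_rd := solution_rd1 Tcl Tub Tt0 g_incr g_onto g_lt gi_g b_rd x_rd x_deriv x_lcont.
  have [F Ff] := rantideriv_exists Tcl Tub Tg0 Tt g0t (f_rd t t0t).
  have w_rd := solution_rd2 Tcl Tub Tt0 g_incr g_onto g_lt gi_g b_rd x_rd x_deriv x_lcont.
  have [W Ww] := rantideriv_exists Tcl Tub Tg0 Tt g0t (w_rd t t0t).
  have [Z ZW] := rantideriv_exists Tcl Tub Tg0 Tt g0t (rantideriv_rd Tcl Tub Ww).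
  have Q_rdt : rd_continuous T (ts_itv T `[t0, t]) Q.
    by apply: rd_subset Q_rd => s /ts_itvcc[Ts ts _]; apply: in0.
  have [q qQ] := rantideriv_exists Tcl Tub Tt0 Tt t0t Q_rdt.
  have sub0 : ts_itv T `[dm h t0, t0] `<=` ts_itv T `[dm h t0, t].
    by move=> s /ts_itvcc[? ? ?]; apply/ts_itvcc; split => //; lra.
  have V0E : V0 = lyapunov (dm h) x lambda F W Z t0.
    rewrite /V0 /lyapunov.
    rewrite (delta_intE Tcl Tub Tg0 Tt0 (ltW g00) _ (rantideriv_sub (lexx _) t0t Ff));
      last exact: rd_subset sub0 (f_rd t t0t).
    have inner s : ts_itv T `[dm h t0, t0] s ->
        delta_int T s t0 (fun u => b (dp h u) ^+ 2 * x u ^+ 2) = W t0 - W s.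
      move=> /ts_itvcc[Ts gs st].
      apply: (delta_intE Tcl Tub Ts Tt0 st); last exact: rantideriv_sub Ww.
      apply: rd_subset (w_rd t t0t) => u /ts_itvcc[Tu su ut].
      by apply/ts_itvcc; split => //; lra.
    (* The inner integral is W t0 - W s, and W t0 * s - Z s is an antiderivative of it. *)
    rewrite (@delta_intE _ _ Tcl Tub _ _ _ (fun s => W t0 * s - Z s) Tg0 Tt0 (ltW g00)).
    + by congr (_ + lambda * _); ring.
    + apply: (@rd_ext _ _ _ (fun s => W t0 + -1 * W s)).
        by move=> s /inner ->; ring.
      apply: rd_continuousD; first exact: rd_continuous_cst.
      apply: rd_continuousM; first exact: rd_continuous_cst.
      exact: rd_subset sub0 (rantideriv_rd Tcl Tub Ww).
    + have [Zr Zl] := ZW; split=> s Ts gs st.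
        rewrite inner; last by apply/ts_itvcc; split => //; apply: ltW.
        have -> : W t0 - W s = W t0 * 1 - W s by rewrite mulr1.
        apply: rderivB => //; last by apply: Zr => //; lra.
        by apply: (@rderivZ _ _ _ _ (W t0) id) => //; apply: rderiv_id.
      apply: lcontB; last by apply: Zl => //; lra.
      by apply: lcontM; [apply: lcont_cst|apply: lcont_id].
  have -> : delta_int T t0 m Q = q m - q t0.
    apply: delta_intE => //; last exact: rantideriv_sub (lexx _) (ltW mt) qQ.
    by apply: rd_subset Q_rd => s /ts_itvcc[Ts ts _]; apply: in0.
  have Qg s : T s -> t0 <= s -> - (lambda * dm' s /
      (s - dm h s + lambda * (s - dm h s + mu T s))) <= a s + b (dp h s).
    by move=> Ts ts; have [] := Q_bounds s (in0 s Ts ts).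
  have Ql s : T s -> t0 <= s -> a s + b (dp h s) <=
      - lambda * (s - dm h s + mu T s) * b (dp h s) ^+ 2 -
      mu T s * (a s + b (dp h s)) ^+ 2.
    by move=> Ts ts; have [] := Q_bounds s (in0 s Ts ts).
  have V0_ge0 : 0 <= V0.
    by rewrite V0E; apply: (lyapunov_ge0 Tcl Tub Tt0 g_incr g_onto g_lt F lam0 Ww ZW).
  (* The midpoint condition says exactly that dm h t is no farther from dm h m than from m. *)
  have LM : Lambda t <= m - dm h t.
    by have := alpha_mid t ((ts_itvcy _ _ _).2 (conj Tt at_)); rewrite /Lambda -/m; lra.
  have key : (1 - 1 / xi t) * x t ^+ 2 <= 2 * V0 * expR (q m - q t0).
    rewrite V0E; exact: (lyapunov_lower Tcl Tub Tt0 g_incr g_onto g_lt g_deriv gi_g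
      x_deriv x_lcont Tt t0t lam0 Ff Ww ZW qQ Qg Ql Tm t0m (ltW mt) (ltW gm) (ltW L0) LM).
  have xi' : 0 < 1 - 1 / xi t by rewrite subr_gt0 ltr_pdivrMr ?mul1r//; lra.
  (* Both sides are nonnegative, so the estimate is squared, which removes the root and the factor 1
     / 2 in the exponent. *)
  rewrite -(@ler_pXn2r _ 2)// ?nnegrE ?mulr_ge0 ?sqrtr_ge0 ?expR_ge0//.
  rewrite exprMn sqr_sqrtr; last by rewrite mulr_ge0// divr_ge0// ltW.
  rewrite real_normK ?num_real// -expRM_natl.
  rewrite (_ : 2%:R * (1 / 2 * _) = q m - q t0); last by field.
  rewrite -(ler_pM2l xi'); apply: le_trans key _.
  by rewrite le_eqVlt; apply/orP; left; apply/eqP; field; rewrite gt_eqF//; lra.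
- move=> t /ts_itvco[Tt t0t tal].
  have N_ge s : ts_itv T `[dm h t0, t0] s -> `|x s| <= norm_psi.
    move=> As; rewrite x_psi//; apply: ub_le_sup; last by exists s.
    (* [sup] dominates its set only when the set is bounded above, which rd-continuity of psi on a
       bounded interval provides. *)
    have [K bK] := rd_bounded Tcl Tub Tg0 Tt0 (ltW g00) psi_rd.
    by exists K => _ [u /ts_itvcc[Tu gu ut] <-]; apply: bK.
  have M0 : 0 <= M := le_trans (normr_ge0 _) (dM t0 (in0 t0 Tt0 (lexx _))).
  have sub_t : ts_itv T `[t0, t] `<=` T by move=> ? [].
  have a_rdt := rd_subset sub_t a_rd.
  have [A0 A0a] := rantideriv_exists Tcl Tub Tt0 Tt t0t a_rdt.
  (* Normalised to vanish at t0, so that its values are the integrals of a from t0. *)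
  have Aa := rantideriv_shift Tub (A0 t0) A0a.
  set A := fun s => A0 s - A0 t0 in Aa.
  have AE s : ts_itv T `[t0, t] s -> delta_int T t0 s a = A s.
    move=> /ts_itvcc[Ts ts st]; rewrite /A; apply: delta_intE => //.
      by apply: rd_subset a_rd => ? [].
    exact: rantideriv_sub A0a.
  set j := fun s => _ * expR (- delta_int T t0 s a).
  have jE s : ts_itv T `[t0, t] s -> j s = `|b s / (1 + mu T s * a s)| * expR (- A s).
    by move=> ts; rewrite /j AE.
  have j_rd : rd_continuous T (ts_itv T `[t0, t]) j.
    apply: rd_ext (fun s ts => esym (jE s ts)) _.
    apply: rd_continuousM.
      apply: rd_continuous_norm; apply: rd_continuousM; first exact: rd_subset b_rd.
      apply: (rd_continuous_invmu Tcl Tub sub_t a_rdt) => s [Ts _].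
      by rewrite gt_eqF// a_pos.
    by apply: rd_cvg => s ts; apply: cvg_expRN; apply: (rantideriv_cvg Tcl Tub Aa).
  have [J Jj] := rantideriv_exists Tcl Tub Tt0 Tt t0t j_rd.
  rewrite AE; last by apply/ts_itvcc.
  rewrite (delta_intE Tcl Tub Tt0 Tt t0t j_rd Jj).
  have x_anti : rantideriv T t0 t (fun s => a s * x s + b s * x (dm h s) * dm' s) x.
    by split=> s Ts ts _; [apply: x_deriv|apply: x_lcont].
  have N0 : 0 <= norm_psi.
    by apply: le_trans (normr_ge0 (x t0)) (N_ge t0 _); apply/ts_itvcc; split => //; apply: ltW.
  have := exp_growth Tcl Tub Tt0 Tt t0t Aa (rantiderivZ Tcl Tub (norm_psi * M) Jj) x_anti.
  have -> : A t0 = 0 by rewrite /A subrr.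
  rewrite oppr0 expR0 mulr1 => growth.
  have H : `|x t| * expR (- A t) <=
      `|x t0| + (norm_psi * M * J t - norm_psi * M * J t0).
    apply: growth => s Ts ts st; first exact: a_pos.
    have mu0 := a_pos s Ts.
    rewrite jE; last by apply/ts_itvcc; split => //; apply: ltW.
    have -> : `|b s / (1 + mu T s * a s)| = `|b s| / (1 + mu T s * a s).
      by rewrite normrM normfV (gtr0_norm mu0).
    rewrite mulrA ler_wpM2r ?expR_ge0// mulrA ler_wpM2r ?invr_ge0 ?(ltW mu0)//.
    rewrite !normrM -mulrA mulrC ler_wpM2r// ler_pM//; last exact: dM (in0 s Ts ts).
    apply: N_ge; apply/ts_itvcc; split.
    + exact: (onto_T g_onto Ts ts).
    + exact: (onto_le g_incr Tt0 Ts).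
    (* As s < t < alpha < h, the delayed argument is at most dm h h = t0, so x is still given there
       by psi. *)
    + have [_ <-] := shift_back_self shift Th (ltW th).
      by apply: (onto_le g_incr) => //; lra.
  have -> : `|x t| = `|x t| * expR (- A t) * expR (A t).
    by rewrite -mulrA -expRD addNr expR0 mulr1.
  rewrite [leRHS]mulrAC ler_wpM2r ?expR_ge0//; apply: le_trans H _.
  have : `|x t0| <= norm_psi.
    by apply: N_ge; apply/ts_itvcc; split => //; apply: ltW.
  lra.
Qed.
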